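(* For all $0<\alpha<1$ we have \[ H(\alpha,\beta)=\overline H(\alpha,\beta)=1-\beta\quad\text{for all }\alpha<\beta\le1, \] \[ V(\alpha,\beta)=\overline V(\alpha,\beta)=\max\left\{\alpha\beta,\ \frac{\beta}{\beta+1}\right\}\quad\text{for all }0<\beta<1/\alpha. \]
   Context: For non-empty $A\subset[0,1]$ and $\beta>0$, $C^{\beta}(A)$ is the set of $\beta$-Hölder continuous functions $f\colon A\to\mathbb R$, i.e. those for which there is $c\in(0,\infty)$ with $|f(x)-f(y)|\le c|x-y|^{\beta}$ for all $x,y\in A$; $C^{\alpha}[0,1]$ is the case $A=[0,1]$. The $\beta$-variation of $f\colon A\to\mathbb R$ is \[ V^{\beta}(f)=\sup\left\{\sum_{i=1}^{n}|f(x_i)-f(x_{i-1})|^{\beta}:\ x_0<\dots<x_n,\ x_i\in A,\ n\in\mathbb N^+\right\}. \] $\dim_{\mathcal H}$ is Hausdorff dimension, and $\overline{\dim}_{\mathcal M}$ is the upper Minkowski (upper box) dimension: for an integer $M\ge2$, $\overline{\dim}_{\mathcal M}A=\limsup_{n\to\infty}\frac{\log N_n(A,M)}{n\log M}$, where $N_n(A,M)$ is the number of intervals $[pM^{-n},(p+1)M^{-n})$, $p\in\{0,\dots,M^n-1\}$, that intersect $A$ (the value does not depend on $M$). For $0<\alpha<1$ and $\beta>0$ define \[ H(\alpha,\beta)=\inf_{f\in C^{\alpha}[0,1]}\sup_{A\subset[0,1]}\{\dim_{\mathcal H}A: f|_A\in C^{\beta}(A)\},\quad V(\alpha,\beta)=\inf_{f\in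 C^{\alpha}[0,1]}\sup_{A\subset[0,1]}\{\dim_{\mathcal H}A: V^{\beta}(f|_A)<\infty\}, \] \[ \overline H(\alpha,\beta)=\inf_{f\in C^{\alpha}[0,1]}\sup_{A\subset[0,1]}\{\overline{\dim}_{\mathcal M}A: f|_A\in C^{\beta}(A)\},\quad \overline V(\alpha,\beta)=\inf_{f\in C^{\alpha}[0,1]}\sup_{A\subset[0,1]}\{\overline{\dim}_{\mathcal M}A: V^{\beta}(f|_A)<\infty\}, \] where the suprema are over arbitrary non-empty subsets $A$. *)

(* Defs.v *)
From mathcomp Require Import all_boot all_order all_algebra.
From mathcomp Require Import all_classical all_reals all_analysis.

Set Implicit Arguments.
Unset Strict Implicit.
Unset Printing Implicit Defensive.

Import Order.TTheory GRing.Theory Num.Theory.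
Import numFieldNormedType.Exports.

Local Open Scope classical_set_scope.
Local Open Scope ring_scope.

(* A function on A is represented by a total function R -> R of which only the
   values on A are used; restriction to a subset B of A is then implicit:
   f|_B is in C^beta(B) iff hoelder_on beta B f. *)
Definition hoelder_on (R : realType) (beta : R) (A : set R) (f : R -> R) : Prop :=
  exists2 c : R, 0 < c &
    forall x y, A x -> A y -> `|f x - f y| <= c * `|x - y| `^ beta.

(* If A has at most one point there is no admissible x, and the supremum is the
   one of the empty set, -oo, which is < +oo as it should be. *)
Definition beta_variation (R : realType) (beta : R) (A : set R) (f : R -> R)
    : \bar R :=
  ereal_sup [set v | exists n (x : nat -> R),
    [/\ (0 < n)%N,
        (forall i, (i < n)%N -> x i < x i.+1),
        (forall i, (i <= n)%N -> A (x i)) &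
        v = (\sum_(i < n) `|f (x i.+1) - f (x i)| `^ beta)%:E]].

(* diam set0 = -oo *)
Definition diam (R : realType) (U : set R) : \bar R :=
  ereal_sup [set `|z.1 - z.2|%:E | z in U `*` U].

(* diam(U)^s, with the usual conventions that the empty set contributes 0 for
   every s, and that a singleton contributes 0^0 = 1 for s = 0. *)
Definition diam_pow (R : realType) (s : R) (U : set R) : \bar R :=
  if `[< U = set0 >] then 0%E else (diam U `^ s)%E.

Definition hausdorff_content (R : realType) (s delta : R) (A : set R) : \bar R :=
  ereal_inf [set (\sum_(0 <= i <oo) diam_pow s (U i))%E | U in
    [set U : nat -> set R |
      A `<=` \bigcup_i U i /\ forall i, (diam (U i) <= delta%:E)%E]].

Definition hausdorff_measure (R : realType) (s : R) (A : set R) : \bar R :=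
  ereal_sup [set hausdorff_content s delta A | delta in [set d : R | 0 < d]].

Definition hausdorff_dim (R : realType) (A : set R) : \bar R :=
  ereal_inf [set s%:E | s in
    [set s : R | 0 <= s /\ hausdorff_measure s A = 0%E]].

Definition box_count (R : realType) (M n : nat) (A : set R) : nat :=
  #|[pred p : 'I_(M ^ n)%N | `[< exists2 x, A x &
      p%:R / M%:R ^+ n <= x < p.+1%:R / M%:R ^+ n >]]|.

(* Since 1 lies in none of the half-open intervals, box_count M n [set 1] = 0;
   ln 0 = 0 gives this singleton its expected dimension 0. *)
Definition upper_minkowski_dim (R : realType) (M : nat) (A : set R) : \bar R :=
  limn_esup (fun n => (ln (box_count M n A)%:R / (n%:R * ln M%:R))%:E).

(* inf over f in C^alpha[0,1] of the sup of dim A over the non-empty subsets A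
   of [0,1] such that the restriction of f to A satisfies P. *)
Definition inf_sup_dim (R : realType) (dim : set R -> \bar R)
    (P : set R -> (R -> R) -> Prop) (alpha : R) : \bar R :=
  ereal_inf [set
    ereal_sup [set dim A | A in
      [set A : set R | [/\ A !=set0, A `<=` `[0, 1] & P A f]]]
    | f in [set f : R -> R | hoelder_on alpha `[0, 1] f]].

Definition finite_variation (R : realType) (beta : R) (A : set R) (f : R -> R)
    : Prop :=
  (beta_variation beta A f < +oo)%E.

Definition H_dim (R : realType) (alpha beta : R) : \bar R :=
  inf_sup_dim (@hausdorff_dim R) (hoelder_on beta) alpha.

Definition V_dim (R : realType) (alpha beta : R) : \bar R :=
  inf_sup_dim (@hausdorff_dim R) (finite_variation beta) alpha.

Definition H_bar (R : realType) (M : nat) (alpha beta : R) : \bar R :=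
  inf_sup_dim (@upper_minkowski_dim R M) (hoelder_on beta) alpha.

Definition V_bar (R : realType) (M : nat) (alpha beta : R) : \bar R :=
  inf_sup_dim (@upper_minkowski_dim R M) (finite_variation beta) alpha.

(* Main.v *)
Require Import Defs.
From mathcomp Require Import all_boot all_order all_algebra.
From mathcomp Require Import all_classical all_reals all_analysis.
From mathcomp Require Import ring lra.

Set Implicit Arguments.
Unset Strict Implicit.
Unset Printing Implicit Defensive.

Import Order.TTheory GRing.Theory Num.Theory.
Import numFieldNormedType.Exports.

Local Open Scope classical_set_scope.
Local Open Scope ring_scope.

(** Both lower bounds hold for every Hoelder function, and both upper bounds come
    from an explicit function; since the Hausdorff dimension never exceeds the
    upper Minkowski dimension ([hausdorff_le_minkowski]), it suffices to bound
    the former from below and the latter from above.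

    Upper bounds.  Fix gamma in (alpha, 1), a large integer n and a = n^-gamma.
    The series f(x) = sum_k a^k t(n^k x), with t a triangle wave of slope 1 or
    -1, is alpha-Hoelder.  Inside a box of length n^-j the partial sum up to k = j
    expands distances by a factor at least (a n)^j / 2, while the remaining terms
    add up to at most 2 a^(j+1) ([zigzag_expands]).  So if f oscillates by
    at most a^(j+1) on the part of A in such a box, this part meets at most
    7 a n = 7 n^(1-gamma) boxes of length n^-(j+1).  With N_j the number of boxes
    meeting A and B_j the number of those on which f oscillates more,
    N_(j+1) <= 7 a n N_j + n B_j ([box_count_step]).  If f is beta-Hoelder on A
    with beta > gamma then B_j vanishes for large j; if f has finite
    beta-variation on A then B_j is at most C n^(gamma beta j).  Hence the upper
    Minkowski dimension of A is at most 1 - gamma + e, respectively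
    max(1 - gamma, gamma beta) + e
    ([restriction_resistant_function]).  In the first case gamma is taken just
    below beta; in the second, just above max(alpha, 1/(1+beta)), the point
    where the maximum is max(alpha beta, beta/(beta+1)).

    Lower bounds.  Let f be given, and index the points of a Cantor set of ratio
    r < 1/2 by binary words.  Each node of the binary tree receives a mass p, a
    window of values of f of length W, and weights on the leaves below it, at
    most 2^-K each for a tree of height K, supported where f takes values in the
    window and of total p W.  One of the two halves of the window carries at
    least half of the weight, so W can be halved, p being kept, until it lies
    between T / 2 and T for a prescribed threshold T ([shrink_window]).  Masses
    are additive over children, and p W <= 2^-d at depth d, so p <= 2^(1-d) / T: a
    Frostman condition, which bounds the dimension of the selected set from below.
    The threshold decides what is obtained ([selection]).
    - T = r^(beta d) makes f beta-Hoelder on the selected set, since points that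
      separate at depth d are at distance about r^d; the dimension tends to
      1 - beta as r tends to 1/2 ([hoelder_set]).
    - T = p^(1/beta), times a factor decaying slowly with d, makes the sum of
      W^beta over all nodes finite, so f has finite beta-variation, and
      p <= 2^(-d beta/(1+beta)) up to that factor ([variation_set]).
    - A constant T keeps a fixed proportion of the mass of the Cantor set, whose
      dimension s can be any number below alpha beta; an alpha-Hoelder function
      has finite beta-variation on it, as 2 r^(alpha beta) < 1
      ([cantor_variation_set]).
    The selected words are parametrized by [0, w) according to mass.  All that
    is needed are inequalities between two points of the parametrization, so
    they survive a limit along an ultrafilter when K tends to infinity
    ([limit_selection]). *)

(** * Real powers *)

Section RealPower.
Variable R : realType.

Lemma le_powRl (s x y : R) : 0 <= s -> 0 <= x -> x <= y -> x `^ s <= y `^ s.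
Proof.
by move=> s0 x0 xy; apply: ge0_ler_powR; rewrite ?nnegrE ?(le_trans x0 xy).
Qed.

Lemma powR_le1 (s x : R) : 0 <= s -> 0 <= x <= 1 -> x `^ s <= 1.
Proof.
by move=> s0 /andP[x0 x1]; apply: le_trans (le_powRl s0 x0 x1) _; rewrite powR1.
Qed.

Lemma powR_lt1 (s x : R) : 0 < s -> 0 < x < 1 -> x `^ s < 1.
Proof.
move=> s0 /andP[x0 x1]; rewrite /powR gt_eqF // -[X in _ < X]expR0 ltr_expR.
by rewrite pmulr_rlt0 // ln_lt0 // x0.
Qed.

Lemma le_powR_root (x s B : R) : 0 < s -> 0 <= B -> B `^ s^-1 <= x -> B <= x `^ s.
Proof.
move=> s0 B0 Bx; have := le_powRl (ltW s0) (powR_ge0 _ _) Bx.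
by rewrite -powRrM mulVf ?gt_eqF // powRr1.
Qed.

Lemma powR_exprn (x s : R) n : 0 <= x -> (x ^+ n) `^ s = (x `^ s) ^+ n.
Proof.
by move=> x0; rewrite -(powR_mulrn _ x0) -(powR_mulrn _ (powR_ge0 _ _)) powRAC.
Qed.

End RealPower.

(** * Hausdorff and Minkowski dimension *)

Section Dimension.
Variable R : realType.

Lemma diam_pow_ge0 s (U : set R) : (0 <= diam_pow s U)%E.
Proof. by rewrite /diam_pow; case: asboolP => // _; apply: poweR_ge0. Qed.

Lemma le_diam (U : set R) x y : U x -> U y -> (`|x - y|%:E <= diam U)%E.
Proof. by move=> Ux Uy; apply: ereal_sup_ubound; exists (x, y). Qed.

Lemma diam_le (U : set R) (D : R) :
  (forall x y, U x -> U y -> `|x - y| <= D) -> (diam U <= D%:E)%E.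
Proof.
by move=> UD; apply: ge_ereal_sup => _ [[x y] /= [Ux Uy] <-]; rewrite lee_fin UD.
Qed.

Lemma diam_fin (U : set R) (D : R) : U !=set0 -> (diam U <= D%:E)%E ->
  exists2 d, 0 <= d <= D & diam U = d%:E.
Proof.
move=> [x Ux]; have := le_diam Ux Ux; rewrite subrr normr0.
case: (diam U) => [d||] //; rewrite !lee_fin => d0 dD.
by exists d; rewrite ?d0.
Qed.

Lemma diam_pow_le s (U : set R) (D : R) : 0 <= s -> 0 <= D ->
  (diam U <= D%:E)%E -> (diam_pow s U <= (D `^ s)%:E)%E.
Proof.
move=> s0 D0 UD; rewrite /diam_pow; case: asboolP => [_|/eqP/set0P U0].
  by rewrite lee_fin powR_ge0.
have [d /andP[d0 dD] ->] := diam_fin U0 UD.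
by rewrite poweR_EFin lee_fin le_powRl.
Qed.

(** The mass distribution principle, with the measure given by a parametrization:
    a covering of A pulls back to a covering of [0, w) by sets of diameter at most
    a constant times the s-th powers of the original diameters, so the length w
    bounds the covering sums from below. *)
Lemma hausdorff_dim_ge (A : set R) (X : R -> R) (w s C : R) : 0 < w -> 0 < s ->
  0 < C -> (forall t, 0 <= t < w -> A (X t)) ->
  (forall t u, 0 <= t -> t <= u -> u < w -> (u - t) `^ s^-1 <= C * (X u - X t)) ->
  (s%:E <= hausdorff_dim A)%E.
Proof.
move=> w0 s0 C0 AX hX; apply: le_ereal_inf_tmp => _ [s' /= [s'0 HA] <-].
rewrite lee_fin leNgt; apply/negP => s's.
have Cs0 : 0 < C `^ s by apply: powR_gt0.
have : (hausdorff_content s' 1 A <= 0)%E.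
  by rewrite -HA; apply: ereal_sup_ubound; exists 1 => //=.
have /[swap] /le_lt_trans/[apply] : (0 < (w / C `^ s)%:E)%E by rewrite lte_fin divr_gt0.
move=> /ereal_inf_lt[_ [U [AU diamU] <-] sumU].
(* Since s' < s and the covering sets have diameter at most 1, the bound of
   exponent s is at most the one of exponent s'. *)
have step t u i : 0 <= t -> t <= u -> u < w -> U i (X t) -> U i (X u) ->
    u - t <= C `^ s * fine (diam_pow s' (U i)).
  move=> t0 tu uw Ut Uu.
  have U0 : U i !=set0 by exists (X t).
  have [d /andP[d0 d1] Ed] := diam_fin U0 (diamU i).
  have -> : fine (diam_pow s' (U i)) = d `^ s'.
    rewrite /diam_pow asboolF ?Ed ?poweR_EFin //.
    by move=> U00; rewrite U00 in Ut.
  have dX : X u - X t <= d.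
    rewrite -lee_fin -Ed; apply: le_trans (le_diam Uu Ut).
    by rewrite lee_fin ler_norm.
  have ut0 : 0 <= u - t by lra.
  have /(le_powRl (ltW s0) (powR_ge0 _ _)) : (u - t) `^ s^-1 <= C * d.
    by apply: le_trans (hX t u t0 tu uw) _; rewrite ler_pM2l.
  rewrite -powRrM mulVf ?gt_eqF // powRr1 // powRM // ?(ltW C0) //.
  move=> /le_trans; apply; rewrite ler_pM2l //.
  move: d0; rewrite le_eqVlt => /predU1P[<-|d0].
    by rewrite (powR0 (lt0r_neq0 s0)) powR_ge0.
  by apply: ger_powR; rewrite ?d0 // ltW.
pose P i := [set t | 0 <= t < w /\ U i (X t)].
pose len i := C `^ s * fine (diam_pow s' (U i)).
pose J i : set R :=
  if `[< P i !=set0 >] then `[inf (P i), inf (P i) + len i]%classic else set0.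
have mJ i : measurable (J i) by rewrite /J; case: asboolP.
have dfin i : diam_pow s' (U i) \is a fin_num.
  rewrite ge0_fin_numE ?diam_pow_ge0 //.
  apply: le_lt_trans (diam_pow_le s'0 _ (diamU i)) _ => //.
  by rewrite ltry.
have len0 i : 0 <= len i by rewrite mulr_ge0 ?powR_ge0 ?fine_ge0 ?diam_pow_ge0.
have muJ i : (lebesgue_measure (J i) <= (C `^ s)%:E * diam_pow s' (U i))%E.
  rewrite /J; case: asboolP => _; last first.
    by rewrite measure0 mule_ge0 ?lee_fin ?powR_ge0 ?diam_pow_ge0.
  rewrite lebesgue_measure_itv /= lte_fin.
  case: ifP => _; last by rewrite mule_ge0 ?lee_fin ?powR_ge0 ?diam_pow_ge0.
  by rewrite -EFinB addrAC subrr add0r /len EFinM fineK.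
have cov : `[0, w[%classic `<=` \bigcup_i J i.
  move=> t /=; rewrite in_itv /= => t01.
  have [i _ Ui] := AU _ (AX t t01).
  exists i => //; rewrite /J asboolT; last by exists t.
  have Pt : P i t by [].
  have hi : has_inf (P i).
    by split; [exists t | exists 0 => z [/andP[]]].
  rewrite /= in_itv /= ge_inf //=; last by case: hi.
  rewrite -lerBlDr; apply: lb_le_inf; first by exists t.
  move=> z [/andP[z0 zw] Uz].
  rewrite lerBlDr -lerBlDl.
  have [tz|zt] := leP z t; first by apply: step => //; case/andP: t01.
  by apply: le_trans (len0 i); lra.
have muw : lebesgue_measure (`[0, w[%classic : set R) = w%:E.
  by rewrite lebesgue_measure_itv /= lte_fin w0 sube0.
have : (w%:E <= \sum_(0 <= i <oo) lebesgue_measure (J i))%E.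
  by rewrite -muw; apply: measure_sigma_subadditive.
apply/negP; rewrite -ltNge.
apply: le_lt_trans (_ : \sum_(0 <= i <oo) ((C `^ s)%:E * diam_pow s' (U i)) < _)%E.
  by apply: lee_nneseries => [i _ _|i _]; [exact: measure_ge0 | exact: muJ].
rewrite nneseriesZl; last by move=> i _; apply: diam_pow_ge0.
by rewrite -lte_pdivlMl // -EFinM mulrC.
Qed.

Lemma hausdorff_dim_ge0 (A : set R) : (0 <= hausdorff_dim A)%E.
Proof. by apply: le_ereal_inf_tmp => _ [s' /= [s'0 _] <-]; rewrite lee_fin. Qed.

Definition box (M n p : nat) : set R :=
  [set x | p%:R / M%:R ^+ n <= x < p.+1%:R / M%:R ^+ n].

Lemma box_dist M n p x y : (0 < M)%N -> box M n p x -> box M n p y ->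
  `|x - y| <= M%:R^-1 ^+ n.
Proof.
move=> M0; rewrite /box /= -addn1 natrD mulrDl mul1r exprVn.
by move=> /andP[x1 x2] /andP[y1 y2]; rewrite ler_norml; lra.
Qed.

Lemma exists_box M n x : (0 < M)%N -> 0 <= x < 1 ->
  exists2 p, (p < M ^ n)%N & box M n p x.
Proof.
move=> M0 /andP[x0 x1]; have Mn : 0 < M%:R ^+ n :> R by rewrite exprn_gt0 // ltr0n.
have xM0 : 0 <= x * M%:R ^+ n by rewrite mulr_ge0 // ltW.
exists (Num.truncn (x * M%:R ^+ n)).
  rewrite truncn_lt_nat // natrX -[X in _ < X]mul1r.
  by rewrite ltr_pM2r.
rewrite /box /= ler_pdivrMr // ltr_pdivlMr //.
exact: truncn_itv.
Qed.

Lemma exists_small (q : R) (e : R) : 0 <= q < 1 -> 0 < e ->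
  exists N, forall n, (N <= n)%N -> q ^+ n <= e.
Proof.
move=> /andP[q0 q1] e0.
have : (fun n => q ^+ n) @ \oo --> (0 : R).
  by apply: cvg_expr; rewrite ger0_norm.
move=> /cvgrPdist_le/(_ e e0)[N _ HN]; exists N => n Nn.
have := HN n Nn; rewrite /= sub0r normrN ger0_norm //; exact: exprn_ge0.
Qed.

(** The boxes of level n that meet A form a covering whose sum at exponent s' is at
    most M^(n (s - s')), which tends to 0. *)
Lemma box_cover_null (A : set R) M (s s' : R) : (2 <= M)%N -> A `<=` `[0, 1] ->
  0 < s -> s < s' ->
  (\forall n \near \oo, (box_count M n A)%:R <= (M%:R ^+ n) `^ s) ->
  hausdorff_measure s' A = 0%E.
Proof.
move=> M2 A01 s0 ss' [N _ HN].
have s'0 : 0 < s' by lra.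
have M0 : (0 < M)%N by apply: leq_trans M2.
have M1 : 1 < M%:R :> R by rewrite ltr1n.
have MR0 : 0 < M%:R :> R by lra.
suff content0 d : 0 < d -> hausdorff_content s' d A = 0%E.
  apply/eqP; rewrite eq_le; apply/andP; split.
    by apply: ge_ereal_sup => _ [d /= d0 <-]; rewrite content0.
  by apply: ereal_sup_ubound; exists 1 => //=; rewrite content0.
move=> d0; apply/eqP; rewrite eq_le; apply/andP; split; last first.
  apply: le_ereal_inf_tmp => _ [U _ <-].
  by apply: nneseries_ge0 => i _ _; apply: diam_pow_ge0.
apply/lee_addgt0Pr => e e0; rewrite add0e.
have q1 : 0 <= (M%:R : R)^-1 < 1 by rewrite invr_ge0 ltW // invf_lt1.
have [N1 HN1] := exists_small q1 d0.
have q2 : 0 <= (M%:R : R) `^ (s - s') < 1.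
  rewrite powR_ge0 /= /powR gt_eqF // -[X in _ < X]expR0 ltr_expR.
  by rewrite pmulr_llt0 ?ln_gt0 //; lra.
have [N2 HN2] := exists_small q2 e0.
pose n := maxn N (maxn N1 N2).
have {}HN1 : M%:R^-1 ^+ n <= d by apply: HN1; rewrite !leq_max leqnn orbT.
have {}HN2 : (M%:R `^ (s - s')) ^+ n <= e by apply: HN2; rewrite !leq_max leqnn !orbT.
have {}HN : (box_count M n A)%:R <= (M%:R ^+ n) `^ s :> R.
  by apply: HN; rewrite /= leq_max leqnn.
(* The point 1 lies in no box, so it gets a covering set of its own. *)
pose U i := A `&` (if (i < M ^ n)%N then box M n i
                   else if i == (M ^ n)%N then [set 1] else set0).
have diamU i : (diam (U i) <= (if (i < M ^ n)%N then M%:R^-1 ^+ n else 0 : R)%:E)%E.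
  apply: diam_le => x y [_ +] [_]; case: ifP => _; first exact: box_dist.
  by case: ifP => // _ -> ->; rewrite subrr normr0.
have cov : A `<=` \bigcup_i U i.
  move=> x Ax; have := A01 x Ax; rewrite /= in_itv /= => /andP[x0].
  rewrite le_eqVlt => /predU1P[x1|x1].
    by exists (M ^ n)%N => //; split; rewrite // ltnn eqxx.
  have [|p pM bx] := @exists_box M n x M0; first by rewrite x0.
  by exists p => //; split; rewrite // pM.
apply: le_trans (_ : \sum_(0 <= i <oo) diam_pow s' (U i) <= _)%E.
  apply: ereal_inf_lbound; exists U => //=; split => // i.
  apply: le_trans (diamU i) _; rewrite lee_fin; case: ifP => // _; exact: ltW.
rewrite (@nneseries_split _ _ 0 (M ^ n)); last by move=> k _; apply: diam_pow_ge0.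
rewrite add0n eseries0 ?adde0; last first.
  move=> i iM _; apply/eqP; rewrite eq_le diam_pow_ge0 andbT.
  have := diamU i; rewrite ltnNge iM /=.
  move=> /(diam_pow_le (ltW s'0) (lexx 0)).
  by rewrite powR0 // gt_eqF.
rewrite big_mkord.
pose c := (M%:R^-1 ^+ n) `^ s' : R.
pose occupied (p : 'I_(M ^ n)%N) := `[< exists2 x, A x & box M n p x >].
apply: le_trans (_ : \sum_(i < M ^ n) (if occupied i then c else 0)%:E <= _)%E.
  apply: lee_sum => i _; have := diamU i; rewrite ltn_ord => dU.
  rewrite /occupied; case: asboolP => [_|nU].
    by apply: diam_pow_le => //; rewrite ?ltW // exprn_ge0 // invr_ge0 ltW.
  rewrite /diam_pow asboolT //; apply/seteqP; split => x //= -[Ax].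
  by rewrite ltn_ord => bx; apply: nU; exists x.
rewrite sumEFin -big_mkcond /= lee_fin sumr_const.
rewrite -[#|_|]/(box_count M n A) -mulr_natl.
apply: le_trans HN2; apply: le_trans (_ : (M%:R ^+ n) `^ s * c <= _).
  by rewrite ler_wpM2r ?powR_ge0.
rewrite /c !powR_exprn ?invr_ge0 ?(ltW MR0) // -exprMn -powR_inv1 ?(ltW MR0) //.
by rewrite -powRrM -powRD ?mulN1r //; apply/implyP => _; rewrite gt_eqF.
Qed.

Lemma hausdorff_le_minkowski (A : set R) M : (2 <= M)%N -> A `<=` `[0, 1] ->
  (hausdorff_dim A <= upper_minkowski_dim M A)%E.
Proof.
move=> M2 A01.
have M1 : 1 < M%:R :> R by rewrite ltr1n.
have MR0 : 0 < M%:R :> R by lra.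
have lnM : 0 < ln (M%:R : R) by rewrite ln_gt0.
have umd0 : (0 <= upper_minkowski_dim M A)%E.
  apply: limf_esup_ge0; first exact: filter_not_empty.
  move=> n; rewrite lee_fin divr_ge0 ?mulr_ge0 // ?(ltW lnM) //.
  case: (box_count M n A) => [|k]; first by rewrite ln0.
  by rewrite ln_ge0 // ler1n.
case Eu : (upper_minkowski_dim M A) umd0 => [u||] // u0; last by rewrite leey.
apply/lee_addgt0Pr => e e0; rewrite -EFinD; rewrite lee_fin in u0.
apply: ereal_inf_lbound; exists (u + e) => //; split; first lra.
apply: (@box_cover_null A M (u + e / 2)) => //; try lra.
have : (upper_minkowski_dim M A < (u + e / 2)%:E)%E by rewrite Eu lte_fin; lra.
move=> /ereal_inf_lt[_ [B ooB <-] supB].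
have : \forall n \near \oo, (0 < n)%N by exists 1%N.
apply: filterS2 ooB => n Bn n0.
case EN : (box_count M n A) => [|k]; first exact: powR_ge0.
have : ((ln (box_count M n A)%:R / (n%:R * ln M%:R))%:E < (u + e / 2)%:E)%E.
  by apply: le_lt_trans supB; apply: ereal_sup_ubound; exists n.
rewrite EN lte_fin ltr_pdivrMr ?mulr_gt0 ?ltr0n // => le_ln.
rewrite -ler_ln ?posrE ?powR_gt0 ?exprn_gt0 //.
rewrite ln_powR lnXn // -(mulr_natl (ln _)).
exact: ltW.
Qed.

End Dimension.

(** * Limits along an ultrafilter *)

Section UltraLimit.
Variable R : realType.

Lemma cvg_ge_near (U : set_system nat) (h : nat -> R) (l c : R) :
  ProperFilter U -> h @ U --> l -> (\forall K \near U, c <= h K) -> c <= l.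
Proof.
move=> UU hl hc; rewrite -(cvg_lim (@norm_hausdorff _ R^o) hl).
by apply: limr_ge => //; apply/cvg_ex; exists l.
Qed.

(** Powers are moved to the other side, where they act on constants, so that only
    the order of the reals is used and not the continuity of powers at 0. *)
Lemma cvg_powR_le (U : set_system nat) (h k : nat -> R) (l m b : R) :
  ProperFilter U -> 0 < b -> (forall n, 0 <= h n) -> h @ U --> l ->
  k @ U --> m -> (forall n, h n `^ b <= k n) -> l `^ b <= m.
Proof.
move=> UU b0 h0 hl km hk; apply/ler_addgt0Pr => e e0.
have l0 : 0 <= l by apply: (cvg_ge_near UU hl); near=> n.
have m0 : 0 <= m.
  by apply: (cvg_ge_near UU km); near=> n; apply: le_trans (hk n); apply: powR_ge0.
have me : 0 < m + e by lra.
suff : l <= (m + e) `^ b^-1.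
  move=> /(ge0_ler_powR (ltW b0)); rewrite !nnegrE l0 powR_ge0 => /(_ isT isT).
  by rewrite -powRrM mulVf ?gt_eqF // powRr1 // ltW.
rewrite -lerN2; apply: (cvg_ge_near UU (cvgN hl)).
have : \forall n \near U, k n <= m + e by apply: (cvgr_le _ km); rewrite ltrDl.
apply: filterS => n kn; rewrite lerN2.
have : (h n `^ b) `^ b^-1 <= (m + e) `^ b^-1.
  apply: ge0_ler_powR; rewrite ?nnegrE ?powR_ge0 ?invr_ge0 ?(ltW b0) ?(ltW me) //.
  exact: le_trans (hk n) kn.
by rewrite -powRrM mulfV ?gt_eqF // powRr1.
Unshelve. all: by end_near. Qed.

Lemma ultra_fmap (T S : choiceType) (U : set_system T) (h : T -> S) :
  UltraFilter U -> UltraFilter (h @ U).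
Proof.
move=> UU; split; first by apply: fmap_proper_filter; apply: ultra_proper.
move=> G PG UG; rewrite eqEsubset; split=> // A GA.
have [//|UnA] := in_ultra_setVsetC (h @^-1` A) UU.
have GnA : G (~` A) by apply: UG.
by have [x []] := filter_ex (filterI GA GnA).
Qed.

(** An ultrafilter yields limits of uncountably many bounded sequences at once;
    here there is one sequence per parameter. *)
Lemma ultra_bounded_cvg (U : set_system nat) (h : nat -> R) (a b : R) :
  UltraFilter U -> (forall n, a <= h n <= b) -> exists2 l, a <= l <= b & h @ U --> l.
Proof.
move=> UU hab; have := @segment_compact R a b.
rewrite compact_ultra => /(_ (h @ U))[].
  exact: ultra_fmap.
  by apply: (@filterE _ U) => n; rewrite /= in_itv /= hab.
by move=> l [/=]; rewrite in_itv /= => lab hl; exists l.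
Qed.

End UltraLimit.

(** * Selecting a large subset of a Cantor set on which a function varies little *)

Section BinaryTree.
Variable R : realType.
Implicit Types (mu g : bitseq -> R).

Fixpoint word_sum (h : nat) mu : R :=
  if h is h'.+1 then
    word_sum h' (fun v => mu (false :: v)) + word_sum h' (fun v => mu (true :: v))
  else mu [::].

Lemma word_sumD h mu nu :
  word_sum h (fun v => mu v + nu v) = word_sum h mu + word_sum h nu.
Proof. by elim: h mu nu => //= h IH mu nu; rewrite !IH addrACA. Qed.

Lemma word_sumZ h c mu : word_sum h (fun v => c * mu v) = c * word_sum h mu.
Proof. by elim: h mu => //= h IH mu; rewrite !IH mulrDr. Qed.

Lemma eq_word_sum h mu nu : mu =1 nu -> word_sum h mu = word_sum h nu.
Proof.
by elim: h mu nu => //= h IH mu nu e; congr (_ + _); apply: IH => v; rewrite e.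
Qed.

Lemma word_sum_ge0 h mu : (forall v, 0 <= mu v) -> 0 <= word_sum h mu.
Proof. by elim: h mu => //= h IH mu m0; rewrite addr_ge0 ?IH. Qed.

Lemma word_sum_le_cst h mu c : (forall v, mu v <= c) -> word_sum h mu <= 2 ^+ h * c.
Proof.
elim: h mu => [mu m|h IH mu m] /=; first by rewrite expr0 mul1r.
have := lerD (IH (fun v => mu (false :: v)) (fun v => m _))
             (IH (fun v => mu (true :: v)) (fun v => m _)).
by move=> /le_trans; apply; rewrite exprS -mulrA mulr_natl mulr2n.
Qed.

Lemma word_sum_cst h c : word_sum h (fun=> c) = 2 ^+ h * c.
Proof.
elim: h => [|h IH] /=; first by rewrite expr0 mul1r.
by rewrite IH exprS -mulrA mulr_natl mulr2n.
Qed.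

Fixpoint cantor_pt (r : R) (v : bitseq) : R :=
  if v is b :: w then (if b then 1 - r else 0) + r * cantor_pt r w else 0.

Lemma cantor_pt01 r v : 0 < r < 2^-1 -> 0 <= cantor_pt r v <= 1.
Proof.
move=> r01; elim: v => [|b v IH] /=; first by rewrite lexx ler01.
by case: b; nra.
Qed.

(** Pigeonhole.  A half of the window that carries at least half of the weight may
    carry more; its weights are scaled down so that the ratio p of weight to window
    length is exactly preserved, which makes masses additive along the tree. *)
Lemma halve_window h mu g p W y : (forall v, 0 <= mu v) -> 0 < p -> 0 < W ->
  word_sum h mu = p * W ->
  (forall v, size v = h -> 0 < mu v -> y <= g v <= y + W) ->
  exists nu z, [/\ forall v, 0 <= nu v <= mu v,
    word_sum h nu = p * (W / 2) &
    forall v, size v = h -> 0 < nu v -> z <= g v <= z + W / 2].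
Proof.
move=> mu0 p0 W0 sum_mu win.
pose lo v := if g v <= y + W / 2 then mu v else 0.
pose hi v := if g v <= y + W / 2 then 0 else mu v.
have lo_mu v : 0 <= lo v <= mu v by rewrite /lo; case: ifP; rewrite ?lexx ?mu0.
have hi_mu v : 0 <= hi v <= mu v by rewrite /hi; case: ifP; rewrite ?lexx ?mu0.
have split_mu : word_sum h mu = word_sum h lo + word_sum h hi.
  rewrite -word_sumD; apply: eq_word_sum => v; rewrite /lo /hi.
  by case: ifP; rewrite (addr0, add0r).
have pW0 : 0 < p * (W / 2) by rewrite mulr_gt0 // divr_gt0.
have scale nu : (forall v, 0 <= nu v <= mu v) -> p * (W / 2) <= word_sum h nu ->
  let c := p * (W / 2) / word_sum h nu in
  (forall v, 0 <= c * nu v <= mu v) /\ word_sum h (fun v => c * nu v) = p * (W / 2).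
  move=> nu_mu le_nu c; have nu0 : 0 < word_sum h nu by apply: lt_le_trans le_nu.
  have c0 : 0 <= c by rewrite divr_ge0 // ltW.
  have c1 : c <= 1 by rewrite ler_pdivrMr // mul1r.
  split; last by rewrite word_sumZ mulrVK // unitfE gt_eqF.
  move=> v; have /andP[n0 n1] := nu_mu v; rewrite mulr_ge0 //=.
  by apply: le_trans n1; rewrite ler_piMl.
have [lo_big|lo_small] := leP (p * (W / 2)) (word_sum h lo).
  have [H1 H2] := scale lo lo_mu lo_big.
  exists (fun v => p * (W / 2) / word_sum h lo * lo v), y; split => // v sv.
  have c0 : 0 < p * (W / 2) / word_sum h lo.
    by rewrite divr_gt0 // (lt_le_trans _ lo_big).
  rewrite (pmulr_rgt0 _ c0) /lo; case: ifP => [gv|_]; last by rewrite ltxx.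
  by move=> /(win v sv); lra.
have hi_big : p * (W / 2) <= word_sum h hi.
  have : p * W = p * (W / 2) + p * (W / 2) by field.
  by move: lo_small; rewrite -sum_mu split_mu; lra.
have [H1 H2] := scale hi hi_mu hi_big.
have c0 : 0 < p * (W / 2) / word_sum h hi by rewrite divr_gt0 // (lt_le_trans _ hi_big).
exists (fun v => p * (W / 2) / word_sum h hi * hi v), (y + W / 2); split => // v sv.
rewrite (pmulr_rgt0 _ c0) /hi; case: ifPn => [_|]; first by rewrite ltxx.
by rewrite -ltNge => gv /(win v sv); lra.
Qed.

(** Halving stops as soon as the window fits below T, so it is still at least T / 2
    long: this lower bound on windows is what limits the mass of a node. *)
Lemma shrink_window h mu g p W y T : (forall v, 0 <= mu v) -> 0 < p -> 0 < T ->
  word_sum h mu = p * W -> T <= 2 * W ->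
  (forall v, size v = h -> 0 < mu v -> y <= g v <= y + W) ->
  exists nu W' z, [/\ forall v, 0 <= nu v <= mu v,
    word_sum h nu = p * W', T <= 2 * W', W' <= T &
    forall v, size v = h -> 0 < nu v -> z <= g v <= z + W'].
Proof.
move=> mu0 p0 T0.
have [n] : exists n : nat, W <= 2 ^+ n * T.
  exists (Num.truncn (W / T)).+1; rewrite -ler_pdivrMr //.
  apply: le_trans (ltW (truncnS_gt _)) _.
  by rewrite -natrX ler_nat ltnW // ltn_expl.
elim: n mu W y mu0 => [|n IH] mu W y mu0 le_W sum_mu T2 win.
  exists mu, W, y; split => //; first by move=> v; rewrite mu0 lexx.
  by rewrite expr0 mul1r in le_W.
have [WT|TW] := leP W T.
  by exists mu, W, y; split => // v; rewrite mu0 lexx.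
have W0 : 0 < W by apply: lt_trans TW.
have [nu [z [nu_mu sum_nu win']]] := halve_window mu0 p0 W0 sum_mu win.
have [] := IH nu (W / 2) z _ _ sum_nu _ win'.
- by move=> v; case/andP: (nu_mu v).
- by rewrite ler_pdivrMr //; apply: le_trans le_W _; rewrite exprS; lra.
- by lra.
move=> nu' [W' [z' [H1 H2 H3 H4 H5]]]; exists nu', W', z'; split => // v.
have /andP[-> le1] := H1 v; have /andP[_ le2] := nu_mu v.
exact: le_trans le2.
Qed.

End BinaryTree.

(** The data steering the selection, for a node of depth d and mass p: T is the
    threshold for its window, F the resulting bound on its mass, J the increment
    charged to the control function when a pair of points separates at this node,
    and V the budget for all the increments at the node and below. *)
Section Selection.
Variable R : realType.
Implicit Types (mu g : bitseq -> R).

Variables (T J V : nat -> R -> R) (F : nat -> R) (r : R).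
Hypothesis r01 : 0 < r < 2^-1.
Hypothesis T_gt0 : forall d p, 0 < p -> 0 < T d p.
Hypothesis T_homo : forall d p q, 0 <= q <= p -> T d.+1 q <= T d p.
Hypothesis mass_bound : forall d p, 0 < p -> p * T d p <= 2 * 2^-1 ^+ d ->
  p <= F d.
Hypothesis J_ge0 : forall d p, 0 <= p -> 0 <= J d p.
Hypothesis V_ge0 : forall d p, 0 <= p -> 0 <= V d p.
Hypothesis V_superadd : forall d p q, 0 <= p -> 0 <= q ->
  J d (p + q) + V d.+1 p + V d.+1 q <= V d (p + q).

(** That v and w part at relative depth k, at a node of mass q, is recorded through the
    distance of their points, which is comparable to r^k; s and t are the values of
    the control function at v and w. *)
Definition separated g d h v w q (s t : R) := exists k,
  [/\ (k < h)%N, 0 < q <= F (d + k)%N,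
      (1 - 2 * r) * r ^+ k <= cantor_pt r w - cantor_pt r v <= r ^+ k,
      `|g w - g v| <= T (d + k)%N q & J (d + k)%N q <= t - s].

(** The parameters [0, p) are split between the two children in proportion to their
    masses, which makes Psi a quantile function for the mass.  At the splitting
    parameter the control function L has left room for the whole budget of the left
    child and is raised by the charge of the node, so that parameters on different
    sides of it have control values at least that charge apart. *)
Lemma selection h d mu g p W y :
  (forall v, 0 <= mu v <= 2^-1 ^+ (d + h)) -> word_sum h mu = p * W ->
  0 <= p -> 0 < W -> T d p <= 2 * W ->
  (forall v, size v = h -> 0 < mu v -> y <= g v <= y + W) ->
  exists (Psi : R -> bitseq) (L : R -> R),
    (forall t, 0 <= t < p -> [/\ size (Psi t) = h, 0 < mu (Psi t) &
       0 <= L t <= V d p]) /\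
    (forall t u, 0 <= t -> t <= u -> u < p -> L t <= L u /\
      ((Psi t = Psi u /\ u - t <= F (d + h)%N) \/
       exists2 q, u - t <= q & separated g d h (Psi t) (Psi u) q (L t) (L u))).
Proof.
elim: h d mu g p W y => [|h IH] d mu g p W y mu_le sum_mu.
  rewrite le_eqVlt => /predU1P[<- W0 _ _|p0 W0 TW win].
    by exists (fun=> [::]), (fun=> 0); split=> [t|t u t0 tu]; lra.
  exists (fun=> [::]), (fun=> 0); split=> [t t01|t u t0 tu up].
    split => //; last by rewrite lexx V_ge0 // ltW.
    by move: sum_mu => /= ->; rewrite mulr_gt0.
  split => //; left; split => //; rewrite addn0.
  have := mu_le [::]; move: sum_mu => /= ->; rewrite addn0 => /andP[_ pW].
  apply: le_trans (mass_bound p0 (d := d) _); first by lra.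
  have : p * T d p <= p * (2 * W) by rewrite ler_pM2l.
  by lra.
move=> p0 W0 TW win.
have {p0} [p0|p0] := leP p 0.
  by exists (fun=> [::]), (fun=> 0); split=> [t|t u t0 tu]; lra.
have [] := shrink_window (fun v => _) p0 (T_gt0 d p0) sum_mu TW win.
  by move=> v; case/andP: (mu_le v).
move=> nu [W' [z [nu_mu sum_nu TW' W'T win']]].
have W'0 : 0 < W' by have := T_gt0 d p0; lra.
have nu_le v : nu v <= mu v by case/andP: (nu_mu v).
pose mass b := word_sum h (fun v => nu (b :: v)) / W'.
have nu0 v : 0 <= nu v by case/andP: (nu_mu v).
have mass_ge0 b : 0 <= mass b by rewrite divr_ge0 ?word_sum_ge0 // ltW.
have massE b : word_sum h (fun v => nu (b :: v)) = mass b * W'.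
  by rewrite mulrVK // unitfE gt_eqF.
have massD : mass false + mass true = p.
  by apply: (mulIf (lt0r_neq0 W'0)); rewrite mulrDl -!massE.
have mass_le b : 0 <= mass b <= p.
  rewrite mass_ge0 -massD; case: b; have := mass_ge0 false;
    by have := mass_ge0 true; lra.
clearbody mass.
have sub b : exists (Psi : R -> bitseq) (L : R -> R),
    (forall t, 0 <= t < mass b -> [/\ size (Psi t) = h,
       0 < nu (b :: Psi t) & 0 <= L t <= V d.+1 (mass b)]) /\
    (forall t u, 0 <= t -> t <= u -> u < mass b -> L t <= L u /\
      ((Psi t = Psi u /\ u - t <= F (d.+1 + h)%N) \/
       exists2 q, u - t <= q &
         separated (fun v => g (b :: v)) d.+1 h (Psi t) (Psi u) q (L t) (L u))).
  apply: (IH d.+1 (fun v => nu (b :: v)) (fun v => g (b :: v)) (mass b) W' z).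
  - move=> v; rewrite nu0 addSnnS; have /andP[_ le1] := nu_mu (b :: v).
    by have /andP[_] := mu_le (b :: v); apply: le_trans.
  - exact: massE.
  - exact: mass_ge0.
  - exact: W'0.
  - by apply: le_trans (T_homo d (mass_le b)) _.
  - by move=> v sv; apply: win'; rewrite /= sv.
have [Psi0 [L0 [PL0 sep0]]] := sub false.
have [Psi1 [L1 [PL1 sep1]]] := sub true.
(* No leaf weighs more than 2^-(d + h.+1), and there are 2^h.+1 of them. *)
have pF : p <= F d.
  apply: mass_bound => //; apply: le_trans (_ : p * (2 * W') <= _).
    by rewrite ler_pM2l.
  have : word_sum h.+1 nu <= 2 ^+ h.+1 * 2^-1 ^+ (d + h.+1).
    apply: word_sum_le_cst => v; have /andP[_] := mu_le v; apply: le_trans.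
    exact: nu_le.
  rewrite sum_nu exprD [X in _ <= X]mulrCA -exprMn divff // expr1n mulr1.
  by lra.
have V0 := V_ge0 d.+1 (mass_ge0 false).
have V1 := V_ge0 d.+1 (mass_ge0 true).
have Jp := J_ge0 d (ltW p0).
have VJ := V_superadd d (mass_ge0 false) (mass_ge0 true); rewrite massD in VJ.
have lift b s w q l l' v : separated (fun v => g (b :: v)) d.+1 h v w q l l' ->
    l' - l = s -> forall m m', m' - m = s ->
    separated g d h.+1 (b :: v) (b :: w) q m m'.
  move=> [k [kh qF dx dg dJ]] ls m m' ms; exists k.+1.
  rewrite addnS -addSn; split => //; last by rewrite ms -ls.
  rewrite /= opprD addrACA subrr add0r -mulrBr exprS mulrCA.
  by have /andP[r0 _] := r01; rewrite !ler_pM2l.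
(* V d.+1 (mass false) bounds L0, so L increases by at least J d p when passing from
   the left child to the right one. *)
exists (fun t => if t < mass false then false :: Psi0 t
                 else true :: Psi1 (t - mass false)).
exists (fun t => if t < mass false then L0 t
                 else V d.+1 (mass false) + J d p + L1 (t - mass false)).
split=> [t /andP[t0 tp]|t u t0 tu up].
  case: ltP => tm.
    have [] := PL0 t; first by rewrite t0.
    by move=> sz nuz Lt; split; [rewrite /= sz | exact: lt_le_trans (nu_le _) | lra].
  have [] := PL1 (t - mass false); first by lra.
  by move=> sz nuz Lt; split; [rewrite /= sz | exact: lt_le_trans (nu_le _) | lra].
have gdist v w : z <= g v <= z + W' -> z <= g w <= z + W' -> `|g w - g v| <= W'.
  by move=> ? ?; rewrite ler_norml; lra.
case: ltP => tm; case: ltP => um; last 1 first.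
- have [|||L01 [[-> uF]|[q uq sep]]] := sep1 (t - mass false) (u - mass false).
  + lra.
  + lra.
  + lra.
  + by split; [lra | left; split => //; rewrite addnS -addSn; lra].
  + split; first lra; right; exists q; first lra.
    by apply: lift sep (erefl _) _ _ _; ring.
- have [|||L01 [[-> uF]|[q uq sep]]] := sep0 t u => //.
  + by split => //; left; split => //; rewrite addnS -addSn.
  + split => //; right; exists q => //.
    exact: lift sep (erefl _) _ _ _.
- have [|sz0 nu_t Lt0] := PL0 t; first by rewrite t0.
  have [|sz1 nu_u Lt1] := PL1 (u - mass false); first by lra.
  split; first lra.
  right; exists p; first lra.
  exists 0; rewrite addn0 expr0 mulr1; split => //.
  + by rewrite p0.
  + have /andP[r0 r2] := r01.
    have rx v : 0 <= r * cantor_pt r v <= r.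
      have /andP[x0 x1] := cantor_pt01 v r01.
      by rewrite mulr_ge0 ?(ltW r0) //= ler_piMr // ltW.
    by rewrite /=; have := rx (Psi0 t); have := rx (Psi1 (u - mass false)); lra.
  + by apply: le_trans W'T; apply: gdist; apply: win'; rewrite //= (sz0, sz1).
  + lra.
- lra.
Qed.

(** The conclusion sought for each pair of points of the set: b = 1/beta and a2 = 0 give
    the Hoelder condition of exponent beta, while b = beta and a1 = 0 bound the
    beta-th powers of increments by those of the control function. *)
Variables (alpha b a1 a2 : R) (f : R -> R).
Hypothesis alpha0 : 0 < alpha.
Hypothesis hf : hoelder_on alpha `[0, 1] f.
Hypothesis b0 : 0 < b.
Hypothesis pair_le : forall d q x x' l, 0 < q <= F d ->
  0 <= x <= 1 -> 0 <= x' <= 1 -> (1 - 2 * r) * r ^+ d <= x' - x <= r ^+ d ->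
  `|f x' - f x| <= T d q -> J d q <= l ->
  `|f x' - f x| `^ b <= a1 * (x' - x) + a2 * l.
Hypothesis a2_ge0 : 0 <= a2.

Section Limit.
Variables (s C W : R).
Hypothesis C0 : 0 <= C.
Hypothesis F_le : forall d q, 0 <= q <= F d -> q `^ s^-1 <= C * r ^+ d.
Hypothesis W0 : 0 < W.
Hypothesis TW : T 0%N W^-1 <= 2 * W.
Hypothesis fW : forall x, 0 <= x <= 1 -> `|f x - f 0| <= W / 2.

(** The depth K enters only through the error C r^K, caused by parameters sent to the
    same word. *)
Lemma finite_selection K : exists X L : R -> R,
  (forall t, 0 <= X t <= 1 /\ 0 <= L t <= V 0%N W^-1) /\
  forall t u, 0 <= t -> t <= u -> u < W^-1 ->
    [/\ X t <= X u, L t <= L u,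
      (u - t) `^ s^-1 <= C / (1 - 2 * r) * (X u - X t) + C * r ^+ K &
      `|f (X u) - f (X t)| `^ b <= a1 * (X u - X t) + a2 * (L u - L t)].
Proof.
have /andP[r0 r2] := r01.
have r12 : 0 < 1 - 2 * r by lra.
have Wi0 : 0 < W^-1 by rewrite invr_gt0.
have [||||||Psi [L [PL sep]]] := @selection K 0%N
    (fun=> 2^-1 ^+ K) (fun v => f (cantor_pt r v)) W^-1 W (f 0 - W / 2).
- by move=> v; rewrite lexx andbT exprn_ge0 // invr_ge0.
- by rewrite word_sum_cst mulVf ?gt_eqF // -exprMn divff // expr1n.
- exact: ltW.
- exact: W0.
- exact: TW.
- move=> v _ _; have := fW (cantor_pt01 v r01).
  by rewrite ler_norml; lra.
have V00 := V_ge0 0%N (ltW Wi0).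
exists (fun t => cantor_pt r (Psi t)).
exists (fun t => if 0 <= t < W^-1 then L t else 0); split=> [t|t u t0 tu uW].
  by split; [exact: cantor_pt01 | case: ifP => [/PL[]//|_]; rewrite lexx].
rewrite t0 (le_trans t0 tu) (le_lt_trans tu uW) uW /=.
have [Ltu sp] := sep t u t0 tu uW.
have CK : 0 <= C * r ^+ K by rewrite mulr_ge0 // exprn_ge0 // ltW.
have ut0 : 0 <= u - t by lra.
case: sp => [[<- utF]|[q utq [k [kK /andP[q0 qF] /andP[dx1 dx2] df dJ]]]].
  rewrite !subrr !mulr0 normr0 powR0 ?gt_eqF // !add0r lexx; split=> //.
    by apply: F_le; rewrite ut0.
  by rewrite mulr_ge0 // subr_ge0.
rewrite add0n in qF df dJ.
have rk0 : 0 < r ^+ k by rewrite exprn_gt0.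
split => //.
- have : 0 < (1 - 2 * r) * r ^+ k by rewrite mulr_gt0.
  by lra.
- apply: le_trans (_ : C * r ^+ k <= _).
    by apply: F_le; rewrite ut0 (le_trans utq).
  rewrite -[X in X <= _]addr0 lerD // -mulrA ler_wpM2l //.
  by rewrite mulrC ler_pdivlMr // mulrC.
- apply: (pair_le (d := k) (q := q)) => //; rewrite ?q0 ?dx1 ?cantor_pt01 //.
Qed.

(** Convergence of f along the limit comes from its Hoelder continuity. *)
Lemma limit_selection : exists X L : R -> R,
  [/\ forall t, 0 <= X t <= 1, forall t, 0 <= L t <= V 0%N W^-1 &
  forall t u, 0 <= t -> t <= u -> u < W^-1 ->
    [/\ X t <= X u, L t <= L u,
      (u - t) `^ s^-1 <= C / (1 - 2 * r) * (X u - X t) &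
      `|f (X u) - f (X t)| `^ b <= a1 * (X u - X t) + a2 * (L u - L t)]].
Proof.
have /choice[X /choice[L XL]] := finite_selection.
have [U [UU ooU]] := ultraFilterLemma eventually_filter.
have PU : ProperFilter U := @ultra_proper _ _ UU.
have X01 n t : 0 <= X n t <= 1 by have [/(_ t)[]] := XL n.
have L0V n t : 0 <= L n t <= V 0%N W^-1 by have [/(_ t)[]] := XL n.
have /choice[Y HY] : forall t, exists l : R, 0 <= l <= 1 /\ (fun n => X n t) @ U --> l.
  by move=> t; have [l] := ultra_bounded_cvg UU (X01 ^~ t); exists l.
have /choice[M HM] : forall t, exists l : R,
    0 <= l <= V 0%N W^-1 /\ (fun n => L n t) @ U --> l.
  by move=> t; have [l] := ultra_bounded_cvg UU (L0V ^~ t); exists l.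
exists Y, M; split => [t|t|t u t0 tu uW]; [by case: (HY t) | by case: (HM t) |].
have [Yt01 Yt] := HY t; have [Yu01 Yu] := HY u.
have [Mt0V Mt] := HM t; have [Mu0V Mu] := HM u.
have dX : (fun n => X n u - X n t) @ U --> Y u - Y t by apply: cvgB.
have dL : (fun n => L n u - L n t) @ U --> M u - M t by apply: cvgB.
have pairs n := proj2 (XL n) t u t0 tu uW.
have fX v : (fun n => f (X n v)) @ U --> f (Y v).
  have [Yv01 Yv] := HY v.
  have [c c0 hc] := hf.
  apply/cvgrPdist_le => e e0.
  pose eta := (e / c) `^ alpha^-1.
  have eta0 : 0 < eta by apply: powR_gt0; apply: divr_gt0.
  move/cvgrPdist_le: Yv => /(_ _ eta0); apply: filterS => n le_eta.
  apply: le_trans (_ : c * `|Y v - X n v| `^ alpha <= _).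
    by apply: hc; rewrite /= in_itv /= ?Yv01 ?X01.
  rewrite mulrC -ler_pdivlMr //.
  have := ge0_ler_powR (ltW alpha0) _ _ le_eta.
  rewrite !nnegrE normr_ge0 powR_ge0 => /(_ isT isT) /le_trans; apply.
  by rewrite -powRrM mulVf ?gt_eqF // powRr1 // ltW // divr_gt0.
split.
- rewrite -subr_ge0; apply: (cvg_ge_near PU dX); apply: filterE => n.
  by rewrite subr_ge0; case: (pairs n).
- rewrite -subr_ge0; apply: (cvg_ge_near PU dL); apply: filterE => n.
  by rewrite subr_ge0; case: (pairs n).
- have rK : (fun n => C * r ^+ n) @ U --> C * 0.
    have rlt1 : `|r| < 1 by have /andP[r0 r2] := r01; rewrite gtr0_norm //; lra.
    have cr : (fun n => r ^+ n) @ \oo --> (0 : R) by exact: (cvg_expr rlt1).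
    have crU : (fun n => r ^+ n) @ U --> (0 : R).
      by move=> A /cr nA; apply: ooU.
    exact: cvgMr.
  have : (fun n => C / (1 - 2 * r) * (X n u - X n t) + C * r ^+ n) @ U -->
      C / (1 - 2 * r) * (Y u - Y t) + C * 0.
    by apply: cvgD => //; apply: cvgMr.
  rewrite mulr0 addr0 => cv; rewrite -subr_ge0.
  apply: (cvg_ge_near PU (cvgB cv (cvg_cst _))); apply: filterE => n /=.
  by rewrite subr_ge0; case: (pairs n).
- apply: (@cvg_powR_le R U (fun n => `|f (X n u) - f (X n t)|)
    (fun n => a1 * (X n u - X n t) + a2 * (L n u - L n t))) => //.
  + by apply: cvg_norm; apply: cvgB.
  + by apply: cvgD; apply: cvgMr.
  + by move=> n; case: (pairs n).
Qed.

End Limit.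

Variable s : R.
Hypothesis s0 : 0 < s.
Hypothesis T_root : forall p, 0 < p <= 1 -> T 0%N p <= 2.
Hypothesis F_geometric : forall d, F d = F 0%N * (r `^ s) ^+ d.

(** The selection for a bounded function: the root window contains the range of f and
    the root mass is the inverse of its length. *)
Lemma selection_set : exists (w v : R) (X L : R -> R),
  let A := X @` `[0, w[%classic in
  [/\ 0 < w, A `<=` `[0, 1], (s%:E <= hausdorff_dim A)%E,
  forall t, 0 <= L t <= v &
  forall t u, 0 <= t -> t <= u -> u < w -> X t <= X u /\
    `|f (X u) - f (X t)| `^ b <= a1 * (X u - X t) + a2 * (L u - L t)].
Proof.
have /andP[r0 r2] := r01.
have [c c0 hc] := hf.
pose W := Num.max 1 (2 * c).
have W1 : 1 <= W by rewrite le_max lexx.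
have W0 : 0 < W by lra.
have TW : T 0%N W^-1 <= 2 * W.
  apply: le_trans (T_root _) _; last by lra.
  by rewrite invr_gt0 W0 invf_le1.
have fW x : 0 <= x <= 1 -> `|f x - f 0| <= W / 2.
  move=> /andP[x0 x1].
  apply: le_trans (_ : c * `|x - 0| `^ alpha <= _).
    by apply: hc; rewrite /= in_itv /= ?x0 ?x1 ?lexx ?ler01.
  apply: le_trans (_ : c <= _); last first.
    by rewrite ler_pdivlMr // mulrC le_max lexx orbT.
  rewrite ler_piMr ?(ltW c0) // subr0 ger0_norm //.
  by rewrite powR_le1 ?x0 // ltW.
have F0 : 0 <= F 0%N.
  apply: le_trans (ler01) _; apply: mass_bound => //.
  by rewrite expr0 mulr1 mul1r T_root // ltr01 lexx.
pose C := F 0%N `^ s^-1.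
have FC d q : 0 <= q <= F d -> q `^ s^-1 <= C * r ^+ d.
  move=> /andP[q0]; rewrite F_geometric => /(le_powRl _ q0) -/(_ s^-1).
  rewrite invr_ge0 ltW // => /(_ isT).
  rewrite powRM ?exprn_ge0 ?powR_ge0 // powR_exprn ?powR_ge0 //.
  by rewrite -powRrM mulfV ?gt_eqF // powRr1 // ltW.
have [X [L [X01 LV XL]]] := limit_selection (powR_ge0 _ _) FC W0 TW fW.
exists W^-1, (V 0%N W^-1), X, L => A; split => //; first by rewrite invr_gt0.
- by move=> _ [t _ <-]; rewrite /= in_itv /= X01.
- have C10 : 0 < C / (1 - 2 * r) + 1.
    by rewrite ltr_pwDr // divr_ge0 ?powR_ge0 //; lra.
  apply: (@hausdorff_dim_ge _ A X W^-1 s (C / (1 - 2 * r) + 1)) => //.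
  + by rewrite invr_gt0.
  + by move=> t tW; exists t; rewrite //= in_itv.
  + move=> t u t0 tu uW; have [Xtu _ le_X _] := XL t u t0 tu uW.
    by apply: le_trans le_X _; rewrite ler_wpM2r ?subr_ge0 //; rewrite lerDl.
- by move=> t u t0 tu uW; have [] := XL t u t0 tu uW.
Qed.

End Selection.

(** * Large subsets with a regular restriction *)

Section Lower.
Variable R : realType.
Implicit Types (f : R -> R).

(** Increments bounded by those of a bounded control function telescope; X being
    monotone, every increasing chain in its range comes from an increasing chain of
    parameters. *)
Lemma control_finite_variation (A : set R) f b w v a (X L : R -> R) :
  A = X @` `[0, w[%classic -> 0 <= a -> (forall t, 0 <= L t <= v) ->
  (forall t u, 0 <= t -> t <= u -> u < w -> X t <= X u /\
    `|f (X u) - f (X t)| `^ b <= a * (L u - L t)) ->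
  finite_variation b A f.
Proof.
move=> -> a0 Lv XL; rewrite /finite_variation.
apply: le_lt_trans (ltry (a * v)).
apply: ge_ereal_sup => _ [n [x [n0 x_lt xA ->]]]; rewrite lee_fin.
have /choice[t ht] : forall i, exists t, (i <= n)%N -> 0 <= t < w /\ X t = x i.
  move=> i; have [/xA[t /=]|] := boolP (i <= n)%N; last by exists 0.
  by rewrite in_itv /= => t0 Xt; exists t.
apply: le_trans (_ : \sum_(i < n) a * (L (t i.+1) - L (t i)) <= _).
  apply: ler_sum => i _.
  have [/andP[t0 tw] Xt] := ht i (ltnW (ltn_ord i)).
  have [/andP[t0' tw'] Xt'] := ht i.+1 (ltn_ord i).
  rewrite -Xt -Xt'; have [ut|tu] := ltP (t i.+1) (t i).
    have [] := XL _ _ t0' (ltW ut) tw; rewrite Xt Xt'.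
    by rewrite leNgt x_lt.
  by have [] := XL _ _ t0 tu tw'.
rewrite -mulr_sumr -(big_mkord xpredT (fun i => L (t i.+1) - L (t i))).
rewrite telescope_sumr // ler_wpM2l //.
by have := Lv (t n); have := Lv (t 0%N); lra.
Qed.

Lemma image_nonempty w (X : R -> R) : 0 < w -> X @` `[0, w[%classic !=set0.
Proof. by move=> w0; exists (X 0), 0; rewrite //= in_itv /= lexx. Qed.

Definition attains_dim f (P : set R -> (R -> R) -> Prop) (s : R) :=
  exists A : set R, [/\ A !=set0, A `<=` `[0, 1], P A f & (s%:E <= hausdorff_dim A)%E].

(** The ratio r solves r^(s + beta) = 1/2, so the mass bound 2 (2 r^beta)^-d at depth
    d is 2 r^(s d); r < 1/2 because s + beta < 1. *)
Lemma hoelder_set alpha beta s f : 0 < alpha -> hoelder_on alpha `[0, 1] f ->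
  0 < beta -> 0 < s -> s < 1 - beta -> attains_dim f (hoelder_on beta) s.
Proof.
move=> alpha0 hf b0 s0 s1.
pose r : R := 2^-1 `^ (s + beta)^-1.
have sb0 : 0 < s + beta by lra.
have r0 : 0 < r by rewrite powR_gt0.
have r12 : r < 2^-1.
  rewrite /r /powR gt_eqF //= -[X in _ < X]lnK ?posrE // ltr_expR lnV ?posrE //.
  have : 1 < (s + beta)^-1 by rewrite invf_gt1 //; lra.
  have : 0 < ln (2 : R) by rewrite ln_gt0 // ltr1n.
  by nra.
have rsb : r `^ s * r `^ beta = 2^-1.
  rewrite -powRD; last by apply/implyP => _; rewrite gt_eqF.
  by rewrite -powRrM mulVf ?gt_eqF // powRr1.
have rho0 : 0 < r `^ beta by rewrite powR_gt0.
have rho1 : r `^ beta <= 1 by rewrite powR_le1 //; lra.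
pose T (d : nat) (_ : R) := (r `^ beta) ^+ d.
pose F d := 2 * (r `^ s) ^+ d.
have T_gt0 d p : 0 < p -> 0 < T d p by move=> _; rewrite exprn_gt0.
have T_homo d p q : 0 <= q <= p -> T d.+1 q <= T d p.
  by move=> _; rewrite /T exprS ler_piMl // exprn_ge0 // ltW.
have T_root p : 0 < p <= 1 -> T 0%N p <= 2 by move=> _; rewrite /T expr0; lra.
have mass d p : 0 < p -> p * T d p <= 2 * 2^-1 ^+ d -> p <= F d.
  by move=> _; rewrite -rsb exprMn mulrA ler_pM2r // exprn_gt0.
have F_le d : F d = F 0%N * (r `^ s) ^+ d by rewrite /F expr0 mulr1.
have r12' : 0 < 1 - 2 * r by lra.
have pair d q x x' l : 0 < q <= F d -> 0 <= x <= 1 -> 0 <= x' <= 1 ->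
    (1 - 2 * r) * r ^+ d <= x' - x <= r ^+ d -> `|f x' - f x| <= T d q -> 0 <= l ->
    `|f x' - f x| `^ beta^-1 <= (1 - 2 * r)^-1 * (x' - x) + 0 * l.
  move=> _ _ _ /andP[dx _] df _; rewrite mul0r addr0 ler_pdivlMl //.
  apply: le_trans dx; rewrite ler_pM2l //.
  have bi0 : 0 <= beta^-1 by rewrite invr_ge0 ltW.
  apply: le_trans (le_powRl bi0 (normr_ge0 _) df) _.
  rewrite /T powR_exprn ?powR_ge0 // -powRrM mulfV ?gt_eqF // powRr1 //.
  exact: ltW.
have [|||w [v [X [L /= [w0 A01 dimA _ XL]]]]] := @selection_set R T (fun _ _ => 0)
  (fun _ _ => 0) F r _ T_gt0 T_homo mass (fun _ _ _ => lexx 0)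
  (fun _ _ _ => lexx 0) _ alpha beta^-1 (1 - 2 * r)^-1 0 f alpha0 hf _ pair (lexx 0)
  s s0 T_root F_le.
- by rewrite r0.
- by move=> *; rewrite !addr0.
- by rewrite invr_gt0.
exists (X @` `[0, w[%classic); split => //; first exact: image_nonempty.
exists ((1 - 2 * r)^-1 `^ beta); first by rewrite powR_gt0 // invr_gt0.
have main t u : 0 <= t -> t <= u -> u < w ->
    `|f (X u) - f (X t)| <= (1 - 2 * r)^-1 `^ beta * `|X u - X t| `^ beta.
  move=> t0 tu uw; have [Xtu] := XL t u t0 tu uw.
  rewrite mul0r addr0 => /(le_powRl (ltW b0) (powR_ge0 _ _)).
  rewrite -powRrM mulVf ?gt_eqF // powRr1 // powRM ?invr_ge0 ?subr_ge0 //; last lra.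
  by rewrite (@ger0_norm _ (X u - X t)) ?subr_ge0.
move=> _ _ [t + <-] [u + <-]; rewrite /= !in_itv /= => /andP[t0 tw] /andP[u0 uw].
have [tu|/ltW ut] := leP t u; last exact: main.
by rewrite distrC [in X in _ <= X]distrC main.
Qed.

(** The threshold is T = (p eta^d)^(1/beta) with eta = z^beta < 1.  The charge of a
    node is p eta^d, which bounds W^beta, and the charges of the nodes of depth d add
    up to eta^d times the total mass.  The factor z^d and the choice r < 1/2 use up
    the gap between s and lam = beta/(beta+1): with th = s/lam < 1, any ka > 1 such
    that ka th < 1 gives r = 2^-ka and z = 2^(ka th - 1), for which r^th z = 1/2. *)
Lemma variation_set alpha beta s f : 0 < alpha -> hoelder_on alpha `[0, 1] f ->
  0 < beta -> 0 < s -> s < beta / (beta + 1) ->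
  attains_dim f (finite_variation beta) s.
Proof.
move=> alpha0 hf b0 s0 s1.
pose lam := beta / (beta + 1).
have lam0 : 0 < lam by rewrite divr_gt0 //; lra.
pose th := s / lam.
have th01 : 0 < th < 1 by rewrite divr_gt0 //= ltr_pdivrMr // mul1r.
pose ka := 2 / (1 + th).
have ka1 : 1 < ka by rewrite ltr_pdivlMr; lra.
have kath : ka * th < 1 by rewrite mulrAC ltr_pdivrMr; lra.
have h01 : 0 < (2^-1 : R) < 1 by lra.
pose r : R := 2^-1 `^ ka.
have r0 : 0 < r by rewrite powR_gt0.
have r12 : r < 2^-1.
  have -> : r = 2^-1 * 2^-1 `^ (ka - 1) by rewrite mulr_powRB1 //; lra.
  by rewrite gtr_pMr // powR_lt1 // subr_gt0.
have r01 : 0 < r < 2^-1 by rewrite r0.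
pose z : R := 2^-1 `^ (1 - ka * th).
have z0 : 0 < z by rewrite powR_gt0.
have z1 : z < 1 by rewrite powR_lt1 // subr_gt0.
have rz : r `^ th * z = 2^-1.
  rewrite -powRrM -powRD ?subrKC ?powRr1 //.
  by apply/implyP => _; rewrite gt_eqF.
pose eta := z `^ beta.
have eta01 : 0 < eta < 1 by rewrite powR_gt0 //= powR_lt1 // z0.
have bi0 : 0 < beta^-1 by rewrite invr_gt0.
pose T (d : nat) (p : R) := p `^ beta^-1 * z ^+ d.
pose J (d : nat) (p : R) := p * eta ^+ d.
pose V (d : nat) (p : R) := p * (eta ^+ d / (1 - eta)).
pose F d := (2 * (r `^ th) ^+ d) `^ lam.
have ed d : 0 < eta ^+ d by case/andP: eta01 => e0 _; rewrite exprn_gt0.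
have T_gt0 d p : 0 < p -> 0 < T d p.
  by move=> p0; rewrite mulr_gt0 ?powR_gt0 ?exprn_gt0.
have T_homo d p q : 0 <= q <= p -> T d.+1 q <= T d p.
  move=> /andP[q0 qp]; apply: ler_pM; rewrite ?powR_ge0 ?exprn_ge0 ?(ltW z0) //.
    by rewrite le_powRl // ltW.
  by rewrite exprS ler_piMl ?exprn_ge0 // ?(ltW z0) ?(ltW z1).
have T_root p : 0 < p <= 1 -> T 0%N p <= 2.
  move=> /andP[p0 p1]; rewrite /T expr0 mulr1.
  have : p `^ beta^-1 <= 1 by rewrite powR_le1 ?p1 ?ltW.
  by lra.
have mass d p : 0 < p -> p * T d p <= 2 * 2^-1 ^+ d -> p <= F d.
  move=> p0; rewrite -rz exprMn /T !mulrA ler_pM2r ?exprn_gt0 // => le_p.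
  have -> : p = (p * p `^ beta^-1) `^ lam.
    rewrite -{2}[p](powRr1 (ltW p0)) -powRD; last by apply/implyP => _; rewrite gt_eqF.
    rewrite -powRrM (_ : (1 + beta^-1) * lam = 1) ?powRr1 // ?(ltW p0) //.
    by rewrite /lam; field; rewrite !gt_eqF //; lra.
  by apply: le_powRl => //; [exact: ltW | rewrite mulr_ge0 ?powR_ge0 // ltW].
have J_ge0 d p : 0 <= p -> 0 <= J d p by move=> p0; rewrite mulr_ge0 // ltW.
have V_ge0 d p : 0 <= p -> 0 <= V d p.
  by move=> p0; rewrite mulr_ge0 // divr_ge0 ?ltW //; lra.
have V_add d p q : 0 <= p -> 0 <= q ->
    J d (p + q) + V d.+1 p + V d.+1 q <= V d (p + q).
  move=> _ _; rewrite /J /V exprS le_eqVlt; apply/orP; left; apply/eqP.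
  by field; lra.
have F_le d : F d = F 0%N * (r `^ s) ^+ d.
  have rth0 : 0 <= r `^ th by apply: powR_ge0.
  rewrite /F expr0 mulr1 (powRM _ _ (exprn_ge0 d rth0)) //.
  rewrite (powR_exprn lam d rth0).
  by rewrite -powRrM /th mulfVK // gt_eqF.
have pair d q x x' l : 0 < q <= F d -> 0 <= x <= 1 -> 0 <= x' <= 1 ->
    (1 - 2 * r) * r ^+ d <= x' - x <= r ^+ d -> `|f x' - f x| <= T d q ->
    J d q <= l -> `|f x' - f x| `^ beta <= 0 * (x' - x) + 1 * l.
  move=> /andP[q0 _] _ _ _ df Jl; rewrite mul0r add0r mul1r; apply: le_trans Jl.
  apply: le_trans (le_powRl (ltW b0) (normr_ge0 _) df) _.
  rewrite /T /J powRM ?powR_ge0 ?exprn_ge0 ?(ltW z0) // powR_exprn ?(ltW z0) //.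
  by rewrite -powRrM mulVf ?gt_eqF // powRr1 // ltW.
have [w [v [X [L /= [w0 A01 dimA Lv XL]]]]] := @selection_set R T J V F r r01 T_gt0
  T_homo mass J_ge0 V_ge0 V_add alpha beta 0 1 f alpha0 hf b0 pair ler01 s s0 T_root
  F_le.
exists (X @` `[0, w[%classic); split => //; first exact: image_nonempty.
apply: (control_finite_variation (erefl _) ler01 Lv) => t u t0 tu uw.
by have := XL t u t0 tu uw; rewrite mul0r add0r.
Qed.

(** With r^s = 1/2 the Cantor set has dimension s; the constant threshold only shrinks
    the window of the root, which keeps a fixed proportion of the mass.  Each
    of the 2^d nodes of depth d is charged r^(alpha beta d), and these charges are
    summable as r^(alpha beta) < 1/2. *)
Lemma cantor_variation_set alpha beta s f : 0 < alpha ->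
  hoelder_on alpha `[0, 1] f -> 0 < beta -> alpha * beta <= 1 -> 0 < s ->
  s < alpha * beta -> attains_dim f (finite_variation beta) s.
Proof.
move=> alpha0 hf b0 ab1 s0 s1; have [c c0 hc] := hf.
have si0 : 0 < s^-1 by rewrite invr_gt0.
have h01 : 0 < (2^-1 : R) < 1 by lra.
pose r : R := 2^-1 `^ s^-1.
have r0 : 0 < r by rewrite powR_gt0.
have r12 : r < 2^-1.
  have -> : r = 2^-1 * 2^-1 `^ (s^-1 - 1) by rewrite mulr_powRB1 //; lra.
  by rewrite gtr_pMr // powR_lt1 // subr_gt0 invf_gt1 //; lra.
have r01 : 0 < r < 2^-1 by rewrite r0.
have rs : r `^ s = 2^-1 by rewrite -powRrM mulVf ?gt_eqF // powRr1.
pose ka := r `^ (alpha * beta).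
have ka0 : 0 < ka by rewrite powR_gt0.
have ka2 : ka < 2^-1.
  have -> : ka = 2^-1 * r `^ (alpha * beta - s).
    by rewrite -rs -powRD ?subrKC //; apply/implyP => _; rewrite gt_eqF.
  by rewrite gtr_pMr // powR_lt1 ?subr_gt0 // r0; lra.
have kd d : 0 < ka ^+ d by rewrite exprn_gt0.
pose T (d : nat) (p : R) := 1 : R.
pose J (d : nat) (p : R) := ka ^+ d.
pose V (d : nat) (p : R) := ka ^+ d / (1 - 2 * ka).
pose F d := 2 * (r `^ s) ^+ d.
have T_root p : 0 < p <= 1 -> T 0%N p <= 2 by move=> _; rewrite /T; lra.
have mass d p : 0 < p -> p * T d p <= 2 * 2^-1 ^+ d -> p <= F d.
  by move=> _; rewrite /F rs mulr1.
have V_ge0 d p : 0 <= p -> 0 <= V d p.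
  by move=> p0; rewrite divr_ge0 ?ltW //; lra.
have V_add d p q : 0 <= p -> 0 <= q ->
    J d (p + q) + V d.+1 p + V d.+1 q <= V d (p + q).
  move=> _ _; rewrite /J /V exprS le_eqVlt; apply/orP; left; apply/eqP.
  by field; lra.
have F_le d : F d = F 0%N * (r `^ s) ^+ d by rewrite /F expr0 mulr1.
have cb0 : 0 <= c `^ beta by rewrite powR_ge0.
have pair d q x x' l : 0 < q <= F d -> 0 <= x <= 1 -> 0 <= x' <= 1 ->
    (1 - 2 * r) * r ^+ d <= x' - x <= r ^+ d -> `|f x' - f x| <= T d q ->
    J d q <= l -> `|f x' - f x| `^ beta <= 0 * (x' - x) + c `^ beta * l.
  move=> _ x01 x01' /andP[dx0 dx] _ Jl; rewrite mul0r add0r.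
  have dx0' : 0 <= x' - x.
    by apply: le_trans dx0; rewrite mulr_ge0 ?exprn_ge0 //; lra.
  apply: le_trans (_ : c `^ beta * ka ^+ d <= _); last by rewrite ler_wpM2l.
  have df : `|f x' - f x| <= c * (r ^+ d) `^ alpha.
    apply: le_trans (hc _ _ _ _) _; rewrite /= ?in_itv //=.
    by rewrite ger0_norm // ler_pM2l // le_powRl // ltW.
  apply: le_trans (le_powRl (ltW b0) (normr_ge0 _) df) _.
  rewrite powRM ?powR_ge0 ?(ltW c0) // ler_wpM2l // /ka.
  by rewrite -powRrM powR_exprn // ltW.
have [w [v [X [L /= [w0 A01 dimA Lv XL]]]]] := @selection_set R T J V F r r01
  (fun _ _ _ => ltr01) (fun _ _ _ _ => lexx 1) mass
  (fun d _ _ => ltW (kd d)) V_ge0 V_add alpha beta 0 (c `^ beta) f alpha0 hf b0 pair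
  cb0 s s0 T_root F_le.
exists (X @` `[0, w[%classic); split => //; first exact: image_nonempty.
apply: (control_finite_variation (erefl _) cb0 Lv) => t u t0 tu uw.
by have := XL t u t0 tu uw; rewrite mul0r add0r.
Qed.

End Lower.

(** * A lacunary series *)

Section Zigzag.
Variable R : realType.

Definition triangle (x : R) : R := `|x - 2 * (Num.floor ((x + 1) / 2))%:~R|.

Lemma triangle_bounds x : 0 <= triangle x <= 1.
Proof.
rewrite /triangle normr_ge0 /=; have := floor_itv ((x + 1) / 2).
by rewrite intrD ler_norml; lra.
Qed.

(** The wave is the distance to the even integers, so it is the minimum of the
    distances to each of them; the Lipschitz bound follows from this. *)
Lemma triangle_le (x : R) (k : int) : triangle x <= `|x - 2 * k%:~R|.
Proof.
rewrite /triangle; have := floor_itv ((x + 1) / 2); set m := Num.floor _.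
rewrite intrD; have [km|mk|->//] := ltgtP k m.
  have : k%:~R + 1 <= m%:~R :> R by rewrite -intrD1 ler_int lezD1.
  by move=> ? ?; rewrite [X in _ <= X]ger0_norm ?ler_norml; lra.
have : m%:~R + 1 <= k%:~R :> R by rewrite -intrD1 ler_int lezD1.
by move=> ? ?; rewrite [X in _ <= X]ler0_norm ?ler_norml; lra.
Qed.

Lemma triangle_lipschitz x y : `|triangle x - triangle y| <= `|x - y|.
Proof.
have half u v : triangle u - triangle v <= `|u - v|.
  rewrite lerBlDr; apply: le_trans (triangle_le u (Num.floor ((v + 1) / 2))) _.
  rewrite [X in _ <= _ + X]/triangle; apply: le_trans (ler_normD _ _).
  by rewrite addrA subrK.
by rewrite ler_norml half andbT lerNl opprB distrC half.
Qed.

Lemma triangle_isometry (p : nat) x y : p%:R <= x < p.+1%:R -> p%:R <= y < p.+1%:R ->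
  `|triangle x - triangle y| = `|x - y|.
Proof.
rewrite -[p.+1]addn1 natrD.
have : p%:R = (odd p)%:R + 2 * p./2%:R :> R.
  by rewrite -{1}(odd_double_half p) natrD -mul2n natrM.
move: (p%:R) (odd p) (p./2) => P [] k /= PE Hx Hy.
  have tE z : P <= z < P + 1 -> triangle z = P + 1 - z.
    move=> Hz; rewrite /triangle (@floor_def _ _ (k%:Z + 1)) ?intrD /=; last lra.
    by rewrite ler0_norm /=; lra.
  by rewrite !tE // opprB addrC addrA subrK distrC.
have tE z : P <= z < P + 1 -> triangle z = z - P.
  move=> Hz; rewrite /triangle (@floor_def _ _ k%:Z) ?intrD /=; last lra.
  by rewrite ger0_norm /=; lra.
by rewrite !tE // opprB addrA subrK.
Qed.

Variables (n : nat) (a : R).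
Hypothesis n2 : (2 <= n)%N.
Hypothesis a0 : 0 < a.
Hypothesis a2 : a <= 2^-1.
Let b : R := n%:R.

Definition zigzag_sum (x : R) (K : nat) : R :=
  \sum_(k < K) a ^+ k * triangle (b ^+ k * x).

Lemma zigzag_sumS x K :
  zigzag_sum x K.+1 = zigzag_sum x K + a ^+ K * triangle (b ^+ K * x).
Proof. by rewrite /zigzag_sum big_ord_recr. Qed.

Lemma zigzag_sum_homo x : {homo zigzag_sum x : m k / (m <= k)%N >-> m <= k}.
Proof.
apply: homo_leq => [y //|y z t|k]; first exact: le_trans.
rewrite zigzag_sumS lerDl mulr_ge0 ?exprn_ge0 ?(ltW a0) //.
by case/andP: (triangle_bounds (b ^+ k * x)).
Qed.

Lemma zigzag_sum_le x K L : zigzag_sum x L <= zigzag_sum x K + 2 * a ^+ K.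
Proof.
have aK : 0 < a ^+ K by rewrite exprn_gt0.
have [LK|/subnKC <-] := leqP L K; first by have := zigzag_sum_homo x LK; lra.
suff : forall d, zigzag_sum x (K + d) <= zigzag_sum x K + 2 * a ^+ K - 2 * a ^+ (K + d).
  have := exprn_gt0 (K.+1 + (L - K.+1)) a0; rewrite addSnnS => + /(_ (L - K.+1).+1).
  by lra.
elim=> [|d IH]; first by rewrite addn0; lra.
rewrite addnS zigzag_sumS; have aKd : 0 < a ^+ (K + d) by rewrite exprn_gt0.
have /andP[_ t1] := triangle_bounds (b ^+ (K + d) * x).
have : a ^+ (K + d) * triangle (b ^+ (K + d) * x) <= a ^+ (K + d).
  by rewrite ler_piMr // ltW.
have : a ^+ (K + d).+1 <= 2^-1 * a ^+ (K + d) by rewrite exprS ler_pM2r.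
by lra.
Qed.

Definition zigzag (x : R) : R := limn (zigzag_sum x).

Lemma zigzag_bounds x K : zigzag_sum x K <= zigzag x <= zigzag_sum x K + 2 * a ^+ K.
Proof.
have cv : cvgn (zigzag_sum x).
  apply: nondecreasing_is_cvgn; first exact: zigzag_sum_homo.
  by exists (zigzag_sum x 0 + 2 * a ^+ 0) => _ [L _ <-]; exact: zigzag_sum_le.
rewrite nondecreasing_cvgn_le //=; last exact: zigzag_sum_homo.
by apply: limr_le => //; apply: filterE => L; exact: zigzag_sum_le.
Qed.

(** The increment of the k-th wave is at most min(1, b^k |x - y|), hence at most the
    alpha-th power of b^k |x - y|; the resulting series is geometric of ratio
    a b^alpha. *)
Lemma zigzag_hoelder alpha (A : set R) : 0 < alpha <= 1 -> a * b `^ alpha < 1 ->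
  hoelder_on alpha A zigzag.
Proof.
move=> /andP[al0 al1]; set ka := a * b `^ alpha => ka1.
have b0 : 0 < b by rewrite ltr0n; apply: leq_trans n2.
have ka0 : 0 < ka by rewrite mulr_gt0 // powR_gt0.
exists (1 - ka)^-1 => [|x y _ _]; first by rewrite invr_gt0 subr_gt0.
set d := `|x - y| `^ alpha.
have d0 : 0 <= d by apply: powR_ge0.
have part K : `|zigzag_sum x K - zigzag_sum y K| <= (1 - ka)^-1 * d * (1 - ka ^+ K).
  elim: K => [|K IH].
    by rewrite /zigzag_sum !big_ord0 subrr normr0 expr0 subrr mulr0.
  rewrite !zigzag_sumS opprD addrACA -mulrBr; apply: le_trans (ler_normD _ _) _.
  rewrite normrM (ger0_norm (exprn_ge0 _ (ltW a0))).
  have dt : `|triangle (b ^+ K * x) - triangle (b ^+ K * y)| <= (b `^ alpha) ^+ K * d.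
    have := triangle_lipschitz (b ^+ K * x) (b ^+ K * y).
    rewrite -mulrBr normrM (ger0_norm (exprn_ge0 _ (ltW b0))) => lip.
    have bK0 := exprn_ge0 K (ltW b0).
    rewrite -(powR_exprn alpha K (ltW b0)) /d -powRM //.
    set D := b ^+ K * `|x - y| in lip *.
    have D0 : 0 <= D by rewrite mulr_ge0.
    have [D1|/ltW D1] := leP D 1.
      apply: le_trans lip _; move: D0; rewrite le_eqVlt => /predU1P[<-|D0].
        exact: powR_ge0.
      by apply: ger1_powR; rewrite ?D0.
    apply: le_trans (_ : 1 <= _).
      have := triangle_bounds (b ^+ K * x); have := triangle_bounds (b ^+ K * y).
      move: (triangle _) (triangle _) => s t; rewrite ler_norml; lra.
    by rewrite -(powRr0 D) ler_powR // ltW.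
  have : a ^+ K * `|triangle (b ^+ K * x) - triangle (b ^+ K * y)| <= ka ^+ K * d.
    by rewrite /ka exprMn -mulrA ler_pM2l // exprn_gt0.
  have -> : (1 - ka)^-1 * d * (1 - ka ^+ K.+1) =
            (1 - ka)^-1 * d * (1 - ka ^+ K) + ka ^+ K * d.
    by rewrite exprS; field; rewrite subr_eq0 gt_eqF.
  by lra.
have D0 : 0 <= (1 - ka)^-1 * d by rewrite mulr_ge0 // invr_ge0; lra.
apply/ler_addgt0Pr => e e0.
have a01 : 0 <= a < 1 by move: a0 a2; lra.
have [K /(_ K (leqnn K)) aK] := exists_small a01 (divr_gt0 e0 (ltr0n R 2)).
have : `|zigzag_sum x K - zigzag_sum y K| <= (1 - ka)^-1 * d.
  by apply: le_trans (part K) _; rewrite ler_piMr // gerBl exprn_ge0 // ltW.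
have := zigzag_bounds x K; have := zigzag_bounds y K.
by rewrite !ler_norml; lra.
Qed.

Hypothesis ab3 : 3 <= a * b.

(** The Lipschitz constants (a b)^k grow at least by a factor 3, so those of the first
    K terms add up to at most half of the next one. *)
Lemma zigzag_sum_lipschitz x y K :
  `|zigzag_sum x K - zigzag_sum y K| <= (a * b) ^+ K / 2 * `|x - y|.
Proof.
have b0 : 0 < b by rewrite ltr0n; apply: leq_trans n2.
elim: K => [|K IH].
  by rewrite /zigzag_sum !big_ord0 subrr normr0 mulr_ge0 // divr_ge0.
rewrite !zigzag_sumS opprD addrACA -mulrBr; apply: le_trans (ler_normD _ _) _.
have : `|a ^+ K * (triangle (b ^+ K * x) - triangle (b ^+ K * y))| <=
    (a * b) ^+ K * `|x - y|.
  rewrite normrM (ger0_norm (exprn_ge0 _ (ltW a0))) exprMn -mulrA.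
  rewrite ler_pM2l ?exprn_gt0 //.
  apply: le_trans (triangle_lipschitz _ _) _.
  by rewrite -mulrBr normrM (ger0_norm (exprn_ge0 _ (ltW b0))).
have abK : 0 <= (a * b) ^+ K * `|x - y|.
  by rewrite mulr_ge0 // exprn_ge0 // mulr_ge0 // ltW.
have : 3 * ((a * b) ^+ K * `|x - y|) <= (a * b) ^+ K.+1 * `|x - y|.
  by rewrite exprS -mulrA ler_wpM2r.
by lra.
Qed.

(** On a box of level j the wave of index j is affine of slope a^j b^j in absolute
    value.  It beats the sum of the previous terms by a factor 2, so the partial sum
    up to j expands distances by (a b)^j / 2; the tail perturbs values by at most
    2 a^(j+1). *)
Lemma zigzag_expands j p x y : box n j p x -> box n j p y ->
  `|zigzag x - zigzag y| <= a ^+ j.+1 -> `|x - y| <= 6 * a / b ^+ j.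
Proof.
move=> bx by_ osc.
have b0 : 0 < b by rewrite ltr0n; apply: leq_trans n2.
have bj : 0 < b ^+ j by rewrite exprn_gt0.
have aj : 0 < a ^+ j by rewrite exprn_gt0.
have iso : `|triangle (b ^+ j * x) - triangle (b ^+ j * y)| = b ^+ j * `|x - y|.
  rewrite (@triangle_isometry p).
  - by rewrite -mulrBr normrM (gtr0_norm bj).
  - by move: bx; rewrite /box /= ler_pdivrMr // ltr_pdivlMr // mulrC.
  - by move: by_; rewrite /box /= ler_pdivrMr // ltr_pdivlMr // mulrC.
have lip := zigzag_sum_lipschitz x y j.
have part : `|zigzag_sum x j.+1 - zigzag_sum y j.+1| <= 3 * a ^+ j.+1.
  have := zigzag_bounds x j.+1; have := zigzag_bounds y j.+1; move: osc.
  by rewrite !ler_norml; lra.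
have main : (a * b) ^+ j * `|x - y| <= 3 * a ^+ j.+1 + (a * b) ^+ j / 2 * `|x - y|.
  have -> : (a * b) ^+ j * `|x - y| =
      `|a ^+ j * (triangle (b ^+ j * x) - triangle (b ^+ j * y))|.
    by rewrite normrM iso (gtr0_norm aj) exprMn mulrA.
  have -> : a ^+ j * (triangle (b ^+ j * x) - triangle (b ^+ j * y)) =
     (zigzag_sum x j.+1 - zigzag_sum y j.+1) - (zigzag_sum x j - zigzag_sum y j).
    by rewrite !zigzag_sumS; ring.
  by apply: le_trans (ler_normB _ _) _; apply: lerD.
rewrite ler_pdivlMr // mulrC.
have : a ^+ j * (b ^+ j * `|x - y|) <= a ^+ j * (6 * a).
  by move: main; rewrite exprS exprMn; lra.
by rewrite ler_pM2l.
Qed.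

End Zigzag.

(** * Counting boxes *)

Section Counting.
Variable R : realType.
Implicit Types (A : set R).

Lemma card_le_width m (S : pred 'I_m) lo w :
  (forall q, S q -> (lo <= q < lo + w)%N) -> (#|S| <= w)%N.
Proof.
move=> Slo; rewrite cardE -(size_iota lo w) -(size_map val).
apply: uniq_leq_size; first by rewrite map_inj_uniq ?enum_uniq //; apply: val_inj.
by move=> _ /mapP[q + ->]; rewrite mem_enum mem_iota; apply: Slo.
Qed.

Lemma card_le_diam m (S : pred 'I_m) w :
  (forall p q, S p -> S q -> (q < p + w)%N) -> (#|S| <= w)%N.
Proof.
move=> Sw; case: (pickP S) => [p0 Sp0|S0]; last by rewrite (eq_card0 S0).
have [p Sp pmin] := arg_minnP (fun q : 'I_m => val q) Sp0.
by apply: (@card_le_width m S p w) => q Sq; rewrite pmin //= Sw.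
Qed.

Definition occupied M n A (p : nat) := `[< exists2 x, A x & @box R M n p x >].

Lemma box_countE M n A :
  box_count M n A = #|[pred p : 'I_(M ^ n)%N | occupied M n A p]|.
Proof. by []. Qed.

Lemma box_parent M n d q x : (0 < M)%N -> @box R M (n + d) q x ->
  box M n (q %/ M ^ d) x.
Proof.
move=> M0; have Md : (0 < M ^ d)%N by rewrite expn_gt0 M0.
have MR k : 0 < M%:R ^+ k :> R by rewrite exprn_gt0 // ltr0n.
have MRd : (M ^ d)%:R = M%:R ^+ d :> R by rewrite natrX.
have lo : (q %/ M ^ d)%:R * M%:R ^+ d <= q%:R :> R.
  by rewrite -MRd -natrM ler_nat leq_trunc_div.
have hi : q.+1%:R <= (q %/ M ^ d).+1%:R * M%:R ^+ d :> R.
  by rewrite -MRd -natrM ler_nat -ltn_divLR.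
move: lo hi; rewrite /box /= exprD; move: (q %/ M ^ d)%:R (q %/ M ^ d).+1%:R => u v.
move: (MR n) (MR d) => Mn0 Md0 lo hi.
rewrite (ler_pdivrMr _ _ (mulr_gt0 Mn0 Md0)) (ltr_pdivlMr _ _ (mulr_gt0 Mn0 Md0)).
rewrite (ler_pdivrMr _ _ Mn0) (ltr_pdivlMr _ _ Mn0) mulrA => /andP[qx xq].
rewrite -(ler_pM2r Md0) (le_trans lo qx) /= -(ltr_pM2r Md0).
exact: lt_le_trans xq hi.
Qed.

Lemma box_inj M n p q x : (0 < M)%N -> @box R M n p x -> box M n q x -> p = q.
Proof.
move=> M0; have MR : 0 < M%:R ^+ n :> R by rewrite exprn_gt0 // ltr0n.
rewrite /box /= !ler_pdivrMr // !ltr_pdivlMr // => /andP[px xp] /andP[qx xq].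
apply/eqP; rewrite eqn_leq -[(p <= q)%N]ltnS -[(q <= p)%N]ltnS -2!(ltr_nat R).
by rewrite (le_lt_trans px xq) (le_lt_trans qx xp).
Qed.

Lemma box_count_mono M n d A : (0 < M)%N ->
  (box_count M n A <= box_count M (n + d) A)%N.
Proof.
move=> M0; rewrite !box_countE.
have lt_div (q : 'I_(M ^ (n + d))%N) : (q %/ M ^ d < M ^ n)%N.
  by rewrite ltn_divLR ?expn_gt0 ?M0 // -expnD.
pose h q := Ordinal (lt_div q).
apply: leq_trans (leq_imset_card h _); apply: subset_leq_card.
apply/fintype.subsetP => p p_occupied.
have /asboolP[x Ax bx] : occupied M n A p by exact: p_occupied.
have MR : 0 < M%:R ^+ n :> R by rewrite exprn_gt0 // ltr0n.
have x01 : 0 <= x < 1.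
  move: bx => /andP[px xp]; rewrite (le_trans _ px) ?divr_ge0 // ?ltW //=.
  apply: lt_le_trans xp _; rewrite ler_pdivrMr // mul1r -natrX ler_nat.
  exact: ltn_ord.
have [q qM bq] := exists_box (n + d) M0 x01.
have q_occupied : occupied M (n + d) A q by apply/asboolP; exists x.
apply/imsetP; exists (Ordinal qM); first exact: q_occupied.
by apply/val_inj => /=; apply: box_inj bx (box_parent M0 bq).
Qed.

Lemma box_count_expn M c n A : box_count (M ^ c) n A = box_count M (c * n) A :> nat.
Proof. by rewrite /box_count /= natrX -exprM -expnM. Qed.

(** A bound along the scales M^(c j) suffices, since box counts increase with the level
    and consecutive scales differ by the constant factor M^c. *)
Lemma minkowski_le A M c (K sigma : R) : (2 <= M)%N -> (0 < c)%N ->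
  0 < K -> 0 <= sigma ->
  (forall j, (box_count (M ^ c) j A)%:R <= K * ((M ^ c)%:R `^ sigma) ^+ j) ->
  (upper_minkowski_dim M A <= sigma%:E)%E.
Proof.
move=> M2 c0 K0 s0 HK; have M0 : (0 < M)%N by apply: leq_trans M2.
have M1 : 1 < M%:R :> R by rewrite ltr1n.
have MR0 : 0 < M%:R :> R by lra.
have lnM0 : 0 < ln (M%:R : R) by rewrite ln_gt0.
pose B := K * (M%:R `^ sigma) ^+ c.
have Ms1 : 1 <= M%:R `^ sigma :> R.
  by rewrite -[X in X <= _](powRr0 M%:R) ler_powR // ltW.
have Ms0 : 0 < M%:R `^ sigma :> R by rewrite powR_gt0.
have B0 : 0 < B by rewrite mulr_gt0 // exprn_gt0.
have le_B l : (box_count M l A)%:R <= B * (M%:R `^ sigma) ^+ l.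
  apply: le_trans (_ : (box_count (M ^ c) (l %/ c).+1 A)%:R <= _).
    rewrite box_count_expn -(subnKC (_ : l <= c * (l %/ c).+1)%N).
      by rewrite ler_nat box_count_mono.
    by rewrite ltnW // mulnC ltn_ceil.
  apply: le_trans (HK _) _; rewrite /B -mulrA ler_pM2l // -exprD.
  rewrite natrX (powR_exprn sigma c (ltW MR0)) -exprM ler_weXn2l // mulnS leq_add2l.
  by rewrite mulnC leq_trunc_div.
apply/lee_addgt0Pr => e e0; rewrite -EFinD.
have [N HN] : exists N, forall l, (N <= l)%N -> ln B <= e * (l%:R * ln M%:R).
  exists (Num.truncn (`|ln B| / (e * ln M%:R))).+1 => l Nl.
  rewrite mulrCA -ler_pdivrMr ?mulr_gt0 //.
  apply: le_trans (_ : `|ln B| / (e * ln M%:R) <= _).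
    by rewrite ler_pM2r ?invr_gt0 ?mulr_gt0 // ler_norm.
  by apply: le_trans (ltW (truncnS_gt _)) _; rewrite ler_nat.
apply: (@le_trans _ _ (ereal_sup [set (fun n => (ln (box_count M n A)%:R /
    (n%:R * ln M%:R))%:E) l | l in [set l | (N.+1 <= l)%N]])).
  by apply: ereal_inf_lbound; exists [set l | (N.+1 <= l)%N] => //; exists N.+1.
apply: ge_ereal_sup => _ [l /= Nl <-]; rewrite lee_fin.
have l0 : 0 < l%:R :> R by rewrite ltr0n; apply: leq_trans Nl.
rewrite ler_pdivrMr ?mulr_gt0 //.
have [N0|N0] := posnP (box_count M l A).
  rewrite N0 ln0 // mulr_ge0 ?mulr_ge0 ?ltW //; lra.
have : ln (box_count M l A)%:R <= ln (B * (M%:R `^ sigma) ^+ l).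
  by rewrite ler_ln ?posrE ?ltr0n ?mulr_gt0 ?exprn_gt0.
rewrite lnM ?posrE ?exprn_gt0 //.
rewrite lnXn // ln_powR -(mulr_natl (sigma * _)).
have := HN l (ltnW Nl).
by rewrite mulrDl mulrCA; lra.
Qed.
End Counting.

(** * Boxes on which the function oscillates *)

Section Recursion.
Variable R : realType.
Implicit Types (A : set R) (f : R -> R).

Definition oscillates f M n A (w : R) (p : nat) := `[< exists x y,
  [/\ A x, A y, box M n p x, box M n p y & w < `|f x - f y|] >].

Definition bad_count f M n A w :=
  #|[pred p : 'I_(M ^ n)%N | oscillates f M n A w p]|.

Lemma card_sum m (b : pred nat) :
  #|[pred p : 'I_m | b p]| = (\sum_(p < m) b p)%N.
Proof.
rewrite -sum1_card big_mkcond; apply: eq_bigr => p _.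
by rewrite inE; case: (b p).
Qed.

Section Step.
Variables (n : nat) (a : R) (A : set R).
Hypothesis n2 : (2 <= n)%N.
Hypothesis a0 : 0 < a.
Hypothesis a2 : a <= 2^-1.
Hypothesis ab3 : 3 <= a * n%:R.
Let f := zigzag n a.
Let bad j := bad_count f n j A (a ^+ j.+1).

(** If f does not oscillate, the part of A in the box has diameter at most 6 a n^-j,
    which is 6 a n lengths of the next level. *)
Lemma children_le j p : ~~ oscillates f n j A (a ^+ j.+1) p ->
  (#|[pred q : 'I_(n ^ j.+1)%N | occupied n j.+1 A q && (q %/ n == p)%N]|)%:R
  <= 7 * (a * n%:R).
Proof.
move=> /asboolPn good.
have n0 : (0 < n)%N by apply: leq_trans n2.
have nR0 : 0 < n%:R :> R by rewrite ltr0n.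
have nj0 : 0 < n%:R ^+ j :> R by rewrite exprn_gt0.
have an0 : 0 <= 6 * (a * n%:R) by move: ab3; lra.
set w := (Num.truncn (6 * (a * n%:R))).+2.
apply: le_trans (_ : w%:R <= _); last first.
  have /andP[tr _] := truncn_itv an0.
  by rewrite /w -addn2 natrD; move: ab3; lra.
rewrite ler_nat; apply: card_le_diam => q q' /=.
move=> /andP[/asboolP[x Ax bx] /eqP qp] /andP[/asboolP[y Ay by_] /eqP qp'].
have bxp : box n j p x.
  by rewrite -qp -[n in (_ %/ n)%N]expn1; apply: box_parent; rewrite ?addn1.
have byp : box n j p y.
  by rewrite -qp' -[n in (_ %/ n)%N]expn1; apply: box_parent; rewrite ?addn1.
have osc : `|f x - f y| <= a ^+ j.+1.
  by rewrite leNgt; apply/negP => osc; apply: good; exists x, y.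
have xy := zigzag_expands n2 a0 a2 ab3 bxp byp osc.
have nj1 : 0 < n%:R ^+ j.+1 :> R by rewrite exprn_gt0.
move: bx by_; rewrite /box /= !ler_pdivrMr // !ltr_pdivlMr //.
move=> /andP[_ xq] /andP[qy _].
have : `|x - y| * n%:R ^+ j.+1 <= 6 * (a * n%:R).
  rewrite exprS mulrC -mulrA -ler_pdivlMl // mulrC -ler_pdivlMr //.
  apply: le_trans xy _; rewrite le_eqVlt; apply/orP; left; apply/eqP.
  by field; rewrite !gt_eqF.
rewrite -{1}(gtr0_norm nj1) -normrM mulrBl ler_norml => /andP[dxy _].
have tr := truncnS_gt (6 * (a * n%:R)).
have : q'%:R < (q + w)%:R :> R.
  rewrite /w -[(_.+2)%N]addn1 addnA natrD; move: xq.
  by rewrite -[q.+1]addn1 !natrD; lra.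
by rewrite ltr_nat.
Qed.

Lemma box_count_step j :
  (box_count n j.+1 A)%:R <=
  7 * (a * n%:R) * (box_count n j A)%:R + n%:R * (bad j)%:R.
Proof.
have n0 : (0 < n)%N by apply: leq_trans n2.
have lt_div (q : 'I_(n ^ j.+1)%N) : (q %/ n < n ^ j)%N by rewrite ltn_divLR // -expnSr.
pose h q := Ordinal (lt_div q).
rewrite box_countE -sum1_card (@partition_big _ _ _ _ _ _ _ h xpredT) //=.
rewrite natr_sum.
apply: le_trans (_ : \sum_(p < n ^ j) (7 * (a * n%:R) * (occupied n j A p)%:R +
   n%:R * (oscillates f n j A (a ^+ j.+1) p)%:R) <= _); last first.
  by rewrite big_split /= -!mulr_sumr -!natr_sum box_countE /bad /bad_count !card_sum.
apply: ler_sum => p _.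
have -> : (\sum_(q < n ^ j.+1 |
      (q \in [pred q : 'I_(n ^ j.+1)%N | occupied n j.+1 A q]) && (h q == p)) 1)%N =
    #|[pred q : 'I_(n ^ j.+1)%N | occupied n j.+1 A q && (q %/ n == p)%N]|.
  by rewrite -sum1_card; apply: eq_bigl => q.
have [osc|good] := boolP (oscillates f n j A (a ^+ j.+1) p).
  rewrite mulr1; apply: ler_wpDl; first by rewrite mulr_ge0 //; move: ab3; lra.
  rewrite ler_nat; apply: (@card_le_width _ _ (p * n)) => q /= /andP[_ /eqP qp].
  by rewrite -qp leq_trunc_div /= -mulSnr ltn_ceil.
rewrite mulr0 addr0.
have [oc|noc] := boolP (occupied n j A p); first by rewrite mulr1; apply: children_le.
rewrite mulr0 (_ : #|_| = 0%N) //; apply: eq_card0 => q; apply/negbTE/negP.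
move=> /andP[/asboolP[x Ax bx] /eqP qp]; move/asboolP: noc; apply.
exists x => //; rewrite -qp -[n in (_ %/ n)%N]expn1.
by apply: box_parent; rewrite ?addn1.
Qed.

(** By induction, the term coming from oscillating boxes being absorbed by the slack 1
    between 7 a n and E. *)
Lemma box_count_bound (K E : R) : 0 <= K -> 7 * (a * n%:R) + 1 <= E ->
  (forall j, (bad j)%:R <= K * E ^+ j) ->
  forall j, (box_count n j A)%:R <= (1 + n%:R * K) * E ^+ j.
Proof.
move=> K0 DE badK; have nR0 : 0 <= n%:R :> R by rewrite ler0n.
have nK0 : 0 <= n%:R * K by rewrite mulr_ge0.
have E0 : 0 < E by move: ab3; lra.
elim=> [|j IH].
  rewrite expr0 mulr1; apply: le_trans (_ : 1 <= _); last by rewrite lerDl.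
  by rewrite lern1 box_countE (leq_trans (max_card _)) // card_ord expn0.
apply: le_trans (box_count_step j) _.
have Ej : 0 < E ^+ j by rewrite exprn_gt0.
have D0 : 0 <= 7 * (a * n%:R) by move: ab3; lra.
have h1 := ler_wpM2l D0 IH.
have h2 := ler_wpM2l nR0 (badK j).
have h3 : (7 * (a * n%:R) + 1) * ((1 + n%:R * K) * E ^+ j) <=
    E * ((1 + n%:R * K) * E ^+ j).
  by rewrite ler_wpM2r // mulr_ge0 ?ltW //; lra.
rewrite exprS; move: h1 h2 h3; set D := 7 * _; set X := E ^+ j in Ej *.
set N := n%:R in nK0 *; nra.
Qed.

End Step.

(** Each oscillating box contributes two consecutive points of the chain; boxes being
    ordered, the chain is extended on the right. *)
Lemma bad_chain f M n A w i : 0 <= w ->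
  let c := (\sum_(p < i) oscillates f M n A w p)%N in
  forall beta, 0 < beta ->
  (0 < c)%N -> exists m (x : nat -> R),
    [/\ (0 < m)%N, forall k, (k < m)%N -> x k < x k.+1,
        forall k, (k <= m)%N -> A (x k), x m < i%:R / M%:R ^+ n &
        c%:R * w `^ beta <= \sum_(k < m) `|f (x k.+1) - f (x k)| `^ beta].
Proof.
move=> w0 /= beta b0; elim: i => [|i IH]; first by rewrite big_ord0.
rewrite big_ord_recr /=; set c := (\sum_(p < i) _)%N in IH *.
have [/asboolP[x0 [y0 [Ax0 Ay0 bx0 by0 osc0]]]|_] :=
  boolP (oscillates f M n A w i); last first.
  rewrite addn0 => /IH[m [x [m0 x_lt xA x_end sum_x]]]; exists m, x; split => //.
  by apply: lt_le_trans x_end _; rewrite ler_wpM2r ?invr_ge0 ?exprn_ge0 // ler_nat.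
move=> _.
have [x [y [xy Ax Ay [bx by_] osc]]] : exists x y, [/\ x < y, A x, A y,
    box M n i x /\ box M n i y & w `^ beta <= `|f y - f x| `^ beta].
  have le_w : w `^ beta <= `|f x0 - f y0| `^ beta by apply: le_powRl => //; apply: ltW.
  have [xy|yx|xy] := ltgtP x0 y0.
  - by exists x0, y0; split => //; rewrite distrC.
  - by exists y0, x0.
  - by move: osc0; rewrite xy subrr normr0 ltNge w0.
have [c0|c0] := posnP c.
  exists 1%N, (fun k => if k is 0%N then x else y); split => //.
  - by case.
  - by case.
  - by case/andP: by_.
  - by rewrite c0 add0n mul1r big_ord1.
have [m [z [m0 z_lt zA z_end sum_z]]] := IH c0.
pose z' k := if (k <= m)%N then z k else if k == m.+1 then x else y.
have zx : z m < x by apply: lt_le_trans z_end _; case/andP: bx.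
have z'1 : z' m.+1 = x by rewrite /z' ltnn eqxx.
have z'2 : z' m.+2 = y by rewrite /z' ltnNge leqnSn /= gtn_eqF.
exists m.+2, z'; split => //.
- move=> k; rewrite ltnS leq_eqVlt => /predU1P[->|]; first by rewrite z'1 z'2.
  rewrite ltnS leq_eqVlt => /predU1P[->|km]; first by rewrite z'1 /z' leqnn.
  by rewrite /z' (ltnW km) km z_lt.
- move=> k _; rewrite /z'; case: ifP => [/zA//|_]; case: ifP => //.
- by rewrite z'2; case/andP: by_.
- rewrite !big_ord_recr /= z'2 z'1 natrD mulrDl mul1r.
  apply: lerD => //; apply: ler_wpDr; first exact: powR_ge0.
  rewrite [leRHS](_ : _ = \sum_(k < m) `|f (z k.+1) - f (z k)| `^ beta) //.
  by apply: eq_bigr => k _; rewrite /z' ltn_ord (ltnW (ltn_ord k)).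
Qed.

Lemma bad_count_variation f A beta : 0 < beta -> finite_variation beta A f ->
  exists2 V, 0 <= V & forall M n w, 0 < w -> (bad_count f M n A w)%:R * w `^ beta <= V.
Proof.
move=> b0 fin.
have [V V0 HV] : exists2 V : R, 0 <= V & (beta_variation beta A f <= V%:E)%E.
  move: fin; rewrite /finite_variation; case: (beta_variation _ _ _) => [v| |] // _.
    by exists (Num.max 0 v); rewrite ?lee_fin le_max lexx ?orbT.
  by exists 0; rewrite ?leNye.
exists V => // M n w w0.
rewrite /bad_count card_sum.
have [->|c0] := posnP (\sum_(p < M ^ n) oscillates f M n A w p)%N.
  by rewrite mul0r.
have [m [x [m0 x_lt xA _ sum_x]]] := bad_chain (ltW w0) b0 c0.
apply: le_trans sum_x _; rewrite -lee_fin; apply: le_trans HV.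
by apply: ereal_sup_ubound; exists m, x.
Qed.

End Recursion.

(** * Functions whose restrictions are irregular *)

Section Final.
Variable R : realType.
Implicit Types (A : set R) (f : R -> R).

Lemma exists_large_power M (X : R) : (2 <= M)%N ->
  exists2 c, (0 < c)%N & X <= (M ^ c)%:R.
Proof.
move=> M2; exists (Num.truncn X).+1 => //.
apply: le_trans (ltW (truncnS_gt X)) _.
by rewrite ler_nat ltnW // ltn_expl.
Qed.

(** The base n is a power of M large enough for n^e to absorb the constant 8 in the
    box counting recursion, as well as to make a at most 1/2 and a n at least 3. *)
Lemma restriction_resistant_function M (gamma e : R) : (2 <= M)%N ->
  0 < gamma < 1 -> 0 < e -> exists f,
  [/\ forall alpha, 0 < alpha < gamma -> hoelder_on alpha `[0, 1] f,
      forall beta A, gamma < beta -> hoelder_on beta A f ->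
        (upper_minkowski_dim M A <= (1 - gamma + e)%:E)%E &
      forall beta A, 0 < beta -> finite_variation beta A f ->
        (upper_minkowski_dim M A <= (Num.max (1 - gamma) (gamma * beta) + e)%:E)%E].
Proof.
move=> M2 /andP[g0 g1] e0.
have g1' : 0 < 1 - gamma by rewrite subr_gt0.
pose X : R := Num.max (2 `^ gamma^-1) (Num.max (3 `^ (1 - gamma)^-1) (8 `^ e^-1)).
have [c c0 Xn] := exists_large_power X M2.
have n2 : (2 <= M ^ c)%N.
  by apply: leq_trans (leq_pexp2l (ltnW M2) c0); rewrite expn1.
move: Xn (n2); set n := (M ^ c)%N in n2 *; rewrite !ge_max => /and3P[X1 X2 X3] _.
have n0 : 0 < n%:R :> R by rewrite ltr0n; apply: leq_trans n2.
have n1 : 1 <= n%:R :> R by rewrite ler1n; apply: leq_trans n2.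
pose a : R := n%:R `^ (- gamma).
have a0 : 0 < a by rewrite powR_gt0.
have a2 : a <= 2^-1.
  by rewrite /a powRN lef_pV2 ?posrE ?powR_gt0 // le_powR_root.
have anE : a * n%:R = n%:R `^ (1 - gamma).
  rewrite addrC powRD; last by apply/implyP => _; rewrite gt_eqF.
  by rewrite powRr1 // ltW.
have an3 : 3 <= a * n%:R by rewrite anE le_powR_root.
have ne8 : 8 <= n%:R `^ e by rewrite le_powR_root.
have ltn1 : 1 < n%:R :> R by rewrite ltr1n.
have nV s : n%:R^-1 `^ s = n%:R `^ (- s) :> R.
  by rewrite -powR_inv1 ?ltW // -powRrM mulN1r.
have neg_power s : s < 0 -> n%:R `^ s < 1 :> R.
  move=> s0; rewrite -[s]opprK -nV powR_lt1 ?oppr_gt0 //.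
  by rewrite invr_gt0 n0 invf_lt1.
pose f := zigzag n a.
have bound A (K s : R) : 0 <= K -> 1 - gamma + e <= s ->
    (forall j, (bad_count f n j A (a ^+ j.+1))%:R <= K * (n%:R `^ s) ^+ j) ->
    (upper_minkowski_dim M A <= s%:E)%E.
  move=> K0 s_ge bad.
  have s0 : 0 <= s by lra.
  apply: (@minkowski_le _ A M c (1 + n%:R * K) s) => // [|j].
    by apply: ltr_wpDr => //; rewrite mulr_ge0 // ltW.
  apply: (@box_count_bound _ n a A n2 a0 a2 an3 K _ K0 _ bad j).
  apply: le_trans (_ : n%:R `^ (1 - gamma + e) <= _); last exact: (ler_powR n1 s_ge).
  rewrite powRD; last by apply/implyP => _; rewrite gt_eqF.
  rewrite -anE; move: an3 ne8; set an := a * _; set ne := _ `^ e => an3 ne8.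
  by nra.
clearbody n; exists f; split.
- move=> alpha /andP[al0 alg]; apply: zigzag_hoelder => //.
    by rewrite al0 /=; lra.
  rewrite -powRD; last by apply/implyP => _; rewrite gt_eqF.
  by apply: neg_power; lra.
- move=> beta A gb [C C0 hC].
  pose q : R := n%:R `^ (gamma - beta).
  have q01 : 0 <= q < 1 by rewrite powR_ge0 neg_power // subr_lt0.
  (* From level j0 on, C n^(-beta j) <= a^(j+1): no box oscillates. *)
  have [j0 Hj0] := exists_small q01 (divr_gt0 a0 C0).
  apply: (@bound A (n ^ j0)%:R) => // j.
  have ns1 : 1 <= n%:R `^ (1 - gamma + e) :> R.
    by rewrite -[X in X <= _](powRr0 n%:R) ler_powR //; lra.
  have [j0j|jj0] := leqP j0 j; last first.
    apply: le_trans (_ : (n ^ j0)%:R <= _); last first.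
      by rewrite ler_peMr // exprn_ege1.
    rewrite ler_nat /bad_count (leq_trans (max_card _)) // card_ord.
    by apply: leq_pexp2l; [exact: ltnW | exact: ltnW].
  rewrite (_ : bad_count _ _ _ _ _ = 0%N) ?mulr_ge0 ?exprn_ge0 ?powR_ge0 //.
  apply: eq_card0 => p; apply/negbTE/negP => /asboolP[x [y [Ax Ay bx by_]]].
  apply/negP; rewrite -leNgt.
  apply: le_trans (hC x y Ax Ay) _.
  have b0 : 0 <= beta by lra.
  have := box_dist (leq_trans (isT : (0 < 2)%N) n2) bx by_.
  move=> /(le_powRl b0 (normr_ge0 _)) h1.
  have h2 : C * q ^+ j <= a by rewrite mulrC -ler_pdivlMr // Hj0.
  have qE : q = (n%:R^-1) `^ beta / a.
    rewrite /q /a nV -powRB; first by congr (_ `^ _); ring.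
    by apply/implyP => _; rewrite gt_eqF.
  have ij0 : 0 <= n%:R^-1 :> R by rewrite invr_ge0 ltW.
  rewrite (powR_exprn beta j ij0) in h1.
  have -> : a ^+ j.+1 = a * a ^+ j by rewrite exprS.
  have aj0 : 0 < a ^+ j by rewrite exprn_gt0.
  rewrite -(ler_pM2l C0) in h1; apply: le_trans h1 _.
  by rewrite -ler_pdivrMr // -mulrA -expr_div_n -qE.
- move=> beta A b0 fin.
  have [V V0 HV] := bad_count_variation b0 fin.
  set s := _ + e.
  have abj j : (a ^+ j.+1) `^ beta = a `^ beta / (n%:R `^ (gamma * beta)) ^+ j.
    have -> : n%:R `^ (gamma * beta) = (a `^ beta)^-1.
      by rewrite -powRrM -powRN; congr (_ `^ _); ring.
    by rewrite (powR_exprn beta j.+1 (ltW a0)) exprVn invrK exprS.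
  apply: (@bound A (V / a `^ beta)).
  - by rewrite divr_ge0 // powR_ge0.
  - by rewrite lerD2r le_max lexx.
  move=> j; have := HV n j (a ^+ j.+1) (exprn_gt0 _ a0).
  rewrite abj; set m := n%:R `^ (gamma * beta).
  have m0 : 0 < m by rewrite powR_gt0.
  have ms : m ^+ j <= (n%:R `^ s) ^+ j.
    apply: lerXn2r; rewrite ?nnegrE ?powR_ge0 // ler_powR //.
    have : gamma * beta <= Num.max (1 - gamma) (gamma * beta).
      by rewrite le_max lexx orbT.
    by rewrite /s; lra.
  rewrite mulrA ler_pdivrMr ?exprn_gt0 // -ler_pdivlMr ?powR_gt0 //.
  move=> /le_trans; apply; rewrite mulrAC ler_wpM2l // divr_ge0 //.
  exact: powR_ge0.
Qed.

Lemma inf_sup_dim_ge (P : set R -> (R -> R) -> Prop) (alpha l : R) :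
  (forall f, P [set 0] f) ->
  (forall f s, hoelder_on alpha `[0, 1] f -> 0 < s < l -> attains_dim f P s) ->
  (l%:E <= inf_sup_dim (@hausdorff_dim R) P alpha)%E.
Proof.
move=> P0 attains; apply: le_ereal_inf_tmp => _ [f hf <-].
apply/lee_addgt0Pr => e e0; rewrite -leeBlDr // -EFinB.
have [le0|gt0] := leP (l - e) 0.
  apply: le_ereal_sup_tmp; exists (hausdorff_dim [set 0 : R]).
    exists [set 0] => //; split => //; first by exists 0.
    by move=> _ ->; rewrite /= in_itv /= lexx ler01.
  by apply: le_trans (hausdorff_dim_ge0 _); rewrite lee_fin.
have [|A [A0 A01 PA dimA]] := attains f (l - e) hf; first by rewrite gt0; lra.
by apply: le_ereal_sup_tmp; exists (hausdorff_dim A) => //; exists A.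
Qed.

Lemma inf_sup_dim_hausdorff_le M (P : set R -> (R -> R) -> Prop) (alpha : R) :
  (2 <= M)%N ->
  (inf_sup_dim (@hausdorff_dim R) P alpha <=
   inf_sup_dim (@upper_minkowski_dim R M) P alpha)%E.
Proof.
move=> M2; apply: le_ereal_inf_tmp => _ [f hf <-].
apply: (@le_trans _ _ (ereal_sup [set hausdorff_dim A | A in
      [set A : set R | [/\ A !=set0, A `<=` `[0, 1] & P A f]]])).
  by apply: ereal_inf_lbound; exists f.
apply: ge_ereal_sup => _ [A [A0 A01 PA] <-].
apply: le_trans (hausdorff_le_minkowski M2 A01) _.
by apply: ereal_sup_ubound; exists A.
Qed.

Lemma inf_sup_dim_le dim (P : set R -> (R -> R) -> Prop) (alpha l : R) :
  (forall e, 0 < e -> exists2 f, hoelder_on alpha `[0, 1] f &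
     forall A, P A f -> (dim A <= (l + e)%:E)%E) ->
  (inf_sup_dim dim P alpha <= l%:E)%E.
Proof.
move=> H; apply/lee_addgt0Pr => e /H[f hf fP].
apply: (@le_trans _ _ (ereal_sup [set dim A | A in
      [set A : set R | [/\ A !=set0, A `<=` `[0, 1] & P A f]]])).
  by apply: ereal_inf_lbound; exists f.
by apply: ge_ereal_sup => _ [A [_ _ PA] <-]; rewrite -EFinD fP.
Qed.

Lemma inf_sup_dim_eq M (P : set R -> (R -> R) -> Prop) (alpha l : R) : (2 <= M)%N ->
  (forall f, P [set 0] f) ->
  (forall f s, hoelder_on alpha `[0, 1] f -> 0 < s < l -> attains_dim f P s) ->
  (forall e, 0 < e -> exists2 f, hoelder_on alpha `[0, 1] f &
     forall A, P A f -> (upper_minkowski_dim M A <= (l + e)%:E)%E) ->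
  inf_sup_dim (@hausdorff_dim R) P alpha = l%:E /\
  inf_sup_dim (@upper_minkowski_dim R M) P alpha = l%:E.
Proof.
move=> M2 P0 /(inf_sup_dim_ge P0) lo /inf_sup_dim_le hi.
have le_dim := inf_sup_dim_hausdorff_le P alpha M2.
split; apply/eqP; rewrite eq_le.
  by rewrite lo (le_trans le_dim hi).
by rewrite hi (le_trans lo le_dim).
Qed.

Lemma hoelder_on1 beta f x : hoelder_on beta [set x] f.
Proof.
exists 1 => // _ _ -> ->; rewrite subrr normr0 mul1r; exact: powR_ge0.
Qed.

Lemma finite_variation1 beta f x : finite_variation beta [set x] f.
Proof.
apply: le_lt_trans (ltry 0); apply: ge_ereal_sup => _ [n [t [n0 t_lt tx ->]]].
by have := t_lt 0%N n0; rewrite (tx 0%N (leq0n n)) (tx 1%N n0) ltxx.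
Qed.

End Final.

Theorem theorem2p8 (R : realType) (M : nat) (hM : (2 <= M)%N)
    (alpha : R) (halpha : 0 < alpha < 1) :
  (forall beta : R, alpha < beta <= 1 ->
     H_dim alpha beta = (1 - beta)%:E /\
     H_bar M alpha beta = (1 - beta)%:E) /\
  (forall beta : R, 0 < beta < 1 / alpha ->
     V_dim alpha beta = (Num.max (alpha * beta) (beta / (beta + 1)))%:E /\
     V_bar M alpha beta = (Num.max (alpha * beta) (beta / (beta + 1)))%:E).
Proof.
have /andP[al0 al1] := halpha.
split=> beta /andP[b_lo b_hi]; apply: inf_sup_dim_eq => //.
- by move=> f; apply: hoelder_on1.
- move=> f s hf /andP[s0 s1]; apply: hoelder_set hf _ _ _ => //; lra.
- move=> e e0.
  (* Close to beta for the sake of the dimension, but above alpha so that the function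
     is alpha-Hoelder. *)
  pose gamma := Num.max ((alpha + beta) / 2) (beta - e / 2).
  have gb : gamma < beta by rewrite gt_max; lra.
  have ga : alpha < gamma by rewrite lt_max; apply/orP; left; lra.
  have ge : beta - e / 2 <= gamma by rewrite le_max lexx orbT.
  have [||f [f_al f_b _]] := @restriction_resistant_function R M gamma (e / 2) hM.
  + by lra.
  + by lra.
  exists f => [|A /(f_b _ _ gb)]; first by apply: f_al; rewrite al0.
  by move=> /le_trans; apply; rewrite lee_fin; lra.
- by move=> f; apply: finite_variation1.
- move=> f s hf /andP[s0]; rewrite lt_max => /orP[s1|s1].
    apply: cantor_variation_set hf _ _ _ _ => //.
    by rewrite mulrC -ler_pdivlMr // ltW.
  exact: variation_set hf _ _ _.
- move=> e e0.
  have b1 : 0 < 1 + beta by lra.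
  (* At g0 one has 1 - g0 <= beta / (beta + 1), and g0 beta is the claimed value;
     gamma exceeds g0 by little enough to keep gamma beta within e / 2 of it. *)
  pose g0 := Num.max alpha (1 + beta)^-1.
  have g01 : 0 < g0 < 1.
    by rewrite lt_max al0 gt_max al1 /= invf_lt1 //; lra.
  pose gamma := Num.min ((g0 + 1) / 2) (g0 + e / (2 * beta)).
  have eb0 : 0 < e / (2 * beta) by rewrite divr_gt0 // mulr_gt0.
  have gg : g0 < gamma by rewrite lt_min; lra.
  have g1 : gamma < 1 by rewrite gt_min; apply/orP; left; lra.
  have gb : gamma * beta <= g0 * beta + e / 2.
    have : gamma <= g0 + e / (2 * beta) by rewrite ge_min lexx orbT.
    move=> /(ler_wpM2r (ltW b_lo)) /le_trans; apply.
    by rewrite le_eqVlt; apply/orP; left; apply/eqP; field; lra.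
  have [||f [f_al _ f_v]] := @restriction_resistant_function R M gamma (e / 2) hM.
  + by lra.
  + by lra.
  exists f => [|A /(f_v _ _ b_lo) /le_trans].
    apply: f_al; rewrite al0 /=; apply: le_lt_trans gg.
    by rewrite le_max lexx.
  apply; rewrite lee_fin.
  have l1 : g0 * beta <= Num.max (alpha * beta) (beta / (beta + 1)).
    by rewrite maxr_pMl ?(ltW b_lo) // [1 + beta]addrC [_^-1 * _]mulrC.
  have l2 : 1 - g0 <= Num.max (alpha * beta) (beta / (beta + 1)).
    rewrite le_max; apply/orP; right.
    have : (1 + beta)^-1 <= g0 by rewrite le_max lexx orbT.
    have -> : beta / (beta + 1) = 1 - (1 + beta)^-1 by field; lra.
    by lra.
  have : Num.max (1 - gamma) (gamma * beta) <=
      Num.max (alpha * beta) (beta / (beta + 1)) + e / 2.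
    by rewrite ge_max; move: (Num.max _ _) l1 l2 => m l1 l2; lra.
  by lra.
Qed.
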